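(* Let $F\in M_{\boldsymbol\Lambda}[\boldsymbol l]$, $\boldsymbol l=(l_1,l_2)$, be a common eigenfunction of the $\mathfrak{sl}_3$ Gaudin Hamiltonians $H_1(\boldsymbol z),\dots,H_n(\boldsymbol z)$ with eigenvalues $\mu_1,\dots,\mu_n$ (so that $\mu_1+\dots+\mu_n=0$). Let $F=F_0+F_1+\cdots$ be its degree decomposition and write $F_0=u_1^{l_1}u_2^{l_2}f$, where $f$ is a polynomial in $y_1^{(j)},y_2^{(j)}$, $j=1,\dots,n-1$. Then the equations $$(K_j(\boldsymbol z)_0F_0)\big|_{\mathfrak D}=0,\qquad j=1,\dots,n-1,$$ have the form $$\Bigl(-\frac{\partial^2 f}{\partial y_1^{(j)}\partial y_1^{(j)}}+\frac{\partial^2 f}{\partial y_1^{(j)}\partial y_2^{(j)}}-\frac{\partial^2 f}{\partial y_2^{(j)}\partial y_2^{(j)}}-\frac{\partial f}{\partial y_1^{(j)}}\sum_{i=1}^n\frac{(\Lambda_i,\alpha_1)}{y_1^{(j)}-z_i}-\frac{\partial f}{\partial y_2^{(j)}}\sum_{i=1}^n\frac{(\Lambda_i,\alpha_2)}{y_1^{(j)}-z_i}+f\sum_{i=1}^n\frac{1}{y_1^{(j)}-z_i}\Bigl(-\mu_i+\sum_{k\neq i}\frac{(\Lambda_i,\Lambda_k)}{z_i-z_k}\Bigr)\Bigr)\Big|_{\mathfrak D}=0 ,\qquad j=1,\dots,n-1.$$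
   Context: **Gaudin model.** $\mathfrak{sl}_3$ has generators $e_{a,b}$ ($a\ne b$), $h_1=e_{1,1}-e_{2,2}$, $h_2=e_{2,2}-e_{3,3}$; $(\cdot,\cdot)$ is the invariant scalar product with $(h_i,h_i)=2$ (also on $\mathfrak h^*$); $\alpha_1,\alpha_2$ are the simple roots; $\Omega\in\mathfrak{sl}_3^{\otimes2}$ is the Casimir element $\sum_i x_i\otimes x_i$, $(x_i)$ an orthonormal basis. Fix pairwise distinct $z_1,\dots,z_n\in\mathbb C$ and weights $\Lambda_1,\dots,\Lambda_n\in\mathfrak h^*$. $M_{\Lambda}$ is the Verma module with highest weight $\Lambda$ and highest weight vector $v_\Lambda$, $M_{\boldsymbol\Lambda}=M_{\Lambda_1}\otimes\dots\otimes M_{\Lambda_n}$, and $M_{\boldsymbol\Lambda}[\boldsymbol l]$ is its subspace of weight $\sum_s\Lambda_s-l_1\alpha_1-l_2\alpha_2$. The Gaudin Hamiltonians are $H_i(\boldsymbol z)=\sum_{j\ne i}\Omega^{(ij)}/(z_i-z_j)$, where $\Omega^{(ij)}$ is $\Omega$ acting in the $i$-th and $j$-th factors; they satisfy $H_1(\boldsymbol z)+\dots+H_n(\boldsymbol z)=0$. **Polynomial representation.** $\mathbb C[x_k^{(i)}]^{i=1,\dots,n}_{k=1,2,3}$ is identified with $M_{\boldsymbol\Lambda}$ by the linear map $\prod_i (x_1^{(i)})^{j_1^i}(x_3^{(i)})^{j_3^i}(x_2^{(i)})^{j_2^i}\mapsto \bigotimes_i e_{2,1}^{j_1^i}e_{3,1}^{j_3^i}e_{3,2}^{j_2^i}v_{\Lambda_i}$.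 Thus all operators act on polynomials in the $x_k^{(i)}$ as differential operators. **Change of variables.** New variables $\boldsymbol u=(u_1,u_2,u_3)$, $\boldsymbol y=(y_k^{(j)})_{k=1,2,3}^{j=1,\dots,n-1}$ are defined by $$\sum_{i=1}^n\frac{x_k^{(i)}}{t-z_i}=u_k\frac{\prod_{j=1}^{n-1}(t-y_k^{(j)})}{\prod_{i=1}^n(t-z_i)},\qquad k=1,2,3,$$ ($t$ an auxiliary variable), i.e. $x_k^{(i)}=u_k\prod_{j}(z_i-y_k^{(j)})/\prod_{s\ne i}(z_i-z_s)$. Away from the hyperplanes $u_k=0$ and $y_k^{(i)}=y_k^{(j)}$ the map $(\boldsymbol u,\boldsymbol y)\mapsto\boldsymbol x$ is an unramified covering, so differential operators in $\boldsymbol x$ are viewed as operators on functions of $(\boldsymbol u,\boldsymbol y)$. $\mathfrak D$ is the subspace of the $(\boldsymbol u,\boldsymbol y)$-space given by $y_1^{(j)}=y_2^{(j)}$, $j=1,\dots,n-1$. **Degree.** A monomial in the $x_k^{(i)}$ lying in $M_{\boldsymbol\Lambda}[\boldsymbol l]$ has degree $d$ if its total degree in $x_3^{(1)},\dots,x_3^{(n)}$ is $d$ (then its total degrees in the $x_1^{(i)}$ and $x_2^{(i)}$ are $l_1-d$ and $l_2-d$). $F_d$ denotes the degree $d$ component of $F\in M_{\boldsymbol\Lambda}[\boldsymbol l]$. In the variables $(\boldsymbol u,\boldsymbol y)$ one has $F_0=u_1^{l_1}u_2^{l_2}f$ with $f$ a polynomial in the $y_1^{(j)},y_2^{(j)}$.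 **The operators $K_j(\boldsymbol z)_0$.** Writing $\partial_{x}$ for $\partial/\partial x$, for $i\neq j$ put $$\begin{aligned}\Omega_0^{(i,j)}={}&(\Lambda_i,\Lambda_j)+\bigl(x_1^{(j)}x_2^{(i)}\partial_{x_2^{(i)}}-x_1^{(i)}x_2^{(j)}\partial_{x_2^{(j)}}\bigr)\bigl(\partial_{x_1^{(i)}}-\partial_{x_1^{(j)}}\bigr)\\&-x_1^{(i)}x_1^{(j)}\bigl(\partial_{x_1^{(i)}}-\partial_{x_1^{(j)}}\bigr)^2-x_2^{(i)}x_2^{(j)}\bigl(\partial_{x_2^{(i)}}-\partial_{x_2^{(j)}}\bigr)^2\\&+\bigl((\Lambda_i,\alpha_1)x_1^{(j)}-(\Lambda_j,\alpha_1)x_1^{(i)}\bigr)\bigl(\partial_{x_1^{(i)}}-\partial_{x_1^{(j)}}\bigr)+\bigl((\Lambda_i,\alpha_2)x_2^{(j)}-(\Lambda_j,\alpha_2)x_2^{(i)}\bigr)\bigl(\partial_{x_2^{(i)}}-\partial_{x_2^{(j)}}\bigr),\end{aligned}$$ $H_i(\boldsymbol z)_0=\sum_{k\ne i}\Omega_0^{(i,k)}/(z_i-z_k)$, and $$K_j(\boldsymbol z)_0=\sum_{i=1}^n\frac{1}{y_1^{(j)}-z_i}\bigl(H_i(\boldsymbol z)_0-\mu_i\bigr),\qquad j=1,\dots,n-1,$$ where the factor $1/(y_1^{(j)}-z_i)$ acts by multiplication after applying $H_i(\boldsymbol z)_0-\mu_i$.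
   Formalization: The three second-derivative terms are stated with the opposite signs, as + ∂²f/∂y_1∂y_1 − ∂²f/∂y_1∂y_2 + ∂²f/∂y_2∂y_2, because the printed signs fail for n=2, Λ_1=Λ_2=0, l=(2,0), F=x_1^{(1)}x_1^{(2)}. *)

(* Defs.v *)
From HB Require Import structures.
From mathcomp Require Import all_boot all_order all_algebra.
From mathcomp Require Import reals complex mpoly.

Set Implicit Arguments.
Unset Strict Implicit.
Unset Printing Implicit Defensive.

Import GRing.Theory.
Local Open Scope ring_scope.

(* Indices run over 'I_3 and start at 0: the matrix unit e_{a,b}, the          *)
(* coordinate u_k and the variables x_k^(i), y_k^(j) have a - 1, b - 1, k - 1  *)
(* as formal indices. The field of complex numbers is R[i], R : realType.      *)

Section Sl3.
Variable R : realType.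
Local Notation C := R[i].

(* sl_3 is the space of traceless matrices: the two axioms constrain sl3_act   *)
(* on these only, and its values on other matrices are never used.             *)
Record sl3_module : Type := Sl3Module {
  sl3_car :> lmodType C;
  sl3_act : 'M[C]_3 -> {linear sl3_car -> sl3_car};
  sl3_act_linear : forall (a : C) (A B : 'M[C]_3) (v : sl3_car),
    \tr A = 0 -> \tr B = 0 ->
    sl3_act (a *: A + B) v = a *: sl3_act A v + sl3_act B v;
  sl3_act_bracket : forall (A B : 'M[C]_3) (v : sl3_car),
    \tr A = 0 -> \tr B = 0 ->
    sl3_act (A *m B - B *m A) v
      = sl3_act A (sl3_act B v) - sl3_act B (sl3_act A v)
}.

(* The invariant scalar product on sl_3 is (A, B) = tr (A B), for which        *)
(* (h_i, h_i) = 2.                                                             *)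
Definition sl3_orthonormal_basis (X : 'I_8 -> 'M[C]_3) : Prop :=
  (forall a, \tr (X a) = 0)
  /\ (forall a b, \tr (X a *m X b) = (a == b)%:R)
  /\ (forall A, \tr A = 0 -> exists c : 'I_8 -> C, A = \sum_a c a *: X a).

(* The dual h^* of the Cartan subalgebra is the space of rows of sum zero, the *)
(* row la being the functional diag(d) |-> sum_k la_k d_k. The scalar product  *)
(* transported to h^* from h is then again sum_k la_k nu_k.                    *)
Definition is_weight (la : 'rV[C]_3) : Prop := \sum_k la 0 k = 0.

Definition wdot (la nu : 'rV[C]_3) : C := \sum_k la 0 k * nu 0 k.

Definition alpha1 : 'rV[C]_3 := delta_mx 0 0 - delta_mx 0 1.
Definition alpha2 : 'rV[C]_3 := delta_mx 0 1 - delta_mx 0 2.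

Definition highest_weight_vector (V : sl3_module) (v : V) (la : 'rV[C]_3) :=
  (forall a b : 'I_3, (a < b)%N -> sl3_act V (delta_mx a b) v = 0)
  /\ (forall d : 'rV[C]_3, \sum_k d 0 k = 0 ->
        sl3_act V (diag_mx d) v = wdot la d *: v).

Definition sl3_hom (V W : sl3_module) (g : {linear V -> W}) : Prop :=
  forall (A : 'M[C]_3) (v : V),
    \tr A = 0 -> g (sl3_act V A v) = sl3_act W A (g v).

(* The Verma module U(sl_3) (x)_{U(b)} C_la, given by the universal property   *)
(* of the induced module.                                                      *)
Definition is_verma (V : sl3_module) (v : V) (la : 'rV[C]_3) : Prop :=
  highest_weight_vector v la
  /\ forall (W : sl3_module) (w : W), highest_weight_vector w la ->
       exists g : {linear V -> W},
         [/\ sl3_hom g, g v = w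
           & forall g' : {linear V -> W}, sl3_hom g' -> g' v = w -> g' =1 g].

End Sl3.

Section TensorProduct.
Variables (R : realType) (n : nat) (V : 'I_n -> sl3_module R).
Local Notation C := R[i].

Definition multilinear (W : lmodType C) (t : (forall i, V i) -> W) : Prop :=
  forall (w : forall i, V i) (i : 'I_n) (a : C) (x y : V i),
    t (dfwith w (a *: x + y)) = a *: t (dfwith w x) + t (dfwith w y).

Definition is_tensor_product (T : lmodType C) (t : (forall i, V i) -> T) :=
  multilinear t
  /\ forall (W : lmodType C) (g : (forall i, V i) -> W), multilinear g ->
       exists h : {linear T -> W},
         (forall w, h (t w) = g w)
         /\ forall h' : {linear T -> W}, (forall w, h' (t w) = g w) -> h' =1 h.

(* act i A is the action of A in the i-th tensor factor.                       *)
Definition is_factor_action (T : lmodType C) (t : (forall i, V i) -> T)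
    (act : 'I_n -> 'M[C]_3 -> {linear T -> T}) : Prop :=
  forall (i : 'I_n) (A : 'M[C]_3) (w : forall i, V i), \tr A = 0 ->
    act i A (t w) = t (dfwith w (sl3_act (V i) A (w i))).

(* The index of the variable x_k^(i).                                          *)
Definition xvar (i : 'I_n) (k : 'I_3) : 'I_(n * 3) := mxvec_index i k.

(* e_{2,1}^{j_1} e_{3,1}^{j_3} e_{3,2}^{j_2} v_i, where j_1, j_2, j_3 are the  *)
(* exponents of x_1^(i), x_2^(i), x_3^(i) in the monomial m.                   *)
Definition pbw_vector (v : forall i, V i) (m : 'X_{1..n * 3}) (i : 'I_n) : V i :=
  iter (m (xvar i 0)) (sl3_act (V i) (delta_mx 1 0))
    (iter (m (xvar i 2)) (sl3_act (V i) (delta_mx 2 0))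
      (iter (m (xvar i 1)) (sl3_act (V i) (delta_mx 2 1)) (v i))).

Definition is_polynomial_identification (T : lmodType C)
    (t : (forall i, V i) -> T) (v : forall i, V i)
    (Phi : {linear {mpoly C[n * 3]} -> T}) : Prop :=
  bijective Phi /\ forall m : 'X_{1..n * 3}, Phi 'X_[m] = t (pbw_vector v m).

End TensorProduct.

Section Gaudin.
Variables (R : realType) (n : nat).
Local Notation C := R[i].
Variable (z : 'I_n -> C).

Section Hamiltonians.
Variables (X : 'I_8 -> 'M[C]_3) (T : lmodType C).
Variable (act : 'I_n -> 'M[C]_3 -> {linear T -> T}).

Definition casimir (i j : 'I_n) (F : T) : T :=
  \sum_a act i (X a) (act j (X a) F).

Definition gaudin (i : 'I_n) (F : T) : T :=
  \sum_(j | j != i) (z i - z j)^-1 *: casimir i j F.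

Definition has_weight (la : 'rV[C]_3) (F : T) : Prop :=
  forall d : 'rV[C]_3, \sum_k d 0 k = 0 ->
    \sum_i act i (diag_mx d) F = wdot la d *: F.

End Hamiltonians.

Definition degree_part (d : nat) (p : {mpoly C[n * 3]}) : {mpoly C[n * 3]} :=
  \sum_(m <- msupp p | (\sum_i m (xvar i 2%R))%N == d) p@_m *: 'X_[m].

Variable (La : 'I_n -> 'rV[C]_3).

Local Notation X i k := ('X_(xvar i k) : {mpoly C[n * 3]}).
Local Notation D i k p := (p^`M(xvar i k)).

(* (d/dx_k^(i) - d/dx_k^(j)) p                                                 *)
Definition dminus (k : 'I_3) (i j : 'I_n) (p : {mpoly C[n * 3]}) :
    {mpoly C[n * 3]} := D i k p - D j k p.

Definition Omega0 (i j : 'I_n) (p : {mpoly C[n * 3]}) : {mpoly C[n * 3]} :=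
  wdot (La i) (La j) *: p
  + (X j 0 * X i 1 * D i 1 (dminus 0 i j p)
     - X i 0 * X j 1 * D j 1 (dminus 0 i j p))
  - X i 0 * X j 0 * dminus 0 i j (dminus 0 i j p)
  - X i 1 * X j 1 * dminus 1 i j (dminus 1 i j p)
  + (wdot (La i) (alpha1 R) *: X j 0 - wdot (La j) (alpha1 R) *: X i 0)
    * dminus 0 i j p
  + (wdot (La i) (alpha2 R) *: X j 1 - wdot (La j) (alpha2 R) *: X i 1)
    * dminus 1 i j p.

Definition H0 (i : 'I_n) (p : {mpoly C[n * 3]}) : {mpoly C[n * 3]} :=
  \sum_(k | k != i) (z i - z k)^-1 *: Omega0 i k p.

(* The change of variables: u 0 k is u_k, y j k is y_k^(j), and the (i, k)     *)
(* entry of the result is x_k^(i).                                             *)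
Definition xcoord (u : 'rV[C]_3) (y : 'M[C]_(n.-1, 3)) : 'M[C]_(n, 3) :=
  \matrix_(i, k) (u 0 k * (\prod_j (z i - y j k))
                  / \prod_(s | s != i) (z i - z s)).

(* Value of a polynomial whose variables are the entries of a matrix; mxvec    *)
(* and mxvec_index use the same enumeration of the entries.                    *)
Definition mx_eval (a b : nat) (A : 'M[C]_(a, b)) (p : {mpoly C[a * b]}) : C :=
  p.@[fun s => mxvec A 0 s].

(* The value of K_j(z)_0 p at the point (u, y).                                *)
Definition K0 (mu : 'I_n -> C) (j : 'I_n.-1) (p : {mpoly C[n * 3]})
    (u : 'rV[C]_3) (y : 'M[C]_(n.-1, 3)) : C :=
  \sum_i (y j 0 - z i)^-1 * mx_eval (xcoord u y) (H0 i p - mu i *: p).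

(* The subspace y_1^(j) = y_2^(j), j = 1, ..., n - 1.                          *)
Definition in_diag (y : 'M[C]_(n.-1, 3)) : Prop := forall j, y j 0 = y j 1.

(* The index of y_1^(j) (k = 0) or y_2^(j) (k = 1) in C[y_1, y_2].             *)
Definition yvar (j : 'I_n.-1) (k : 'I_2) : 'I_(n.-1 * 2) := mxvec_index j k.

(* The value at (y_1, y_2) of a polynomial in the y_1^(j), y_2^(j): the column *)
(* of the y_3^(j) is removed.                                                  *)
Definition y12_eval (y : 'M[C]_(n.-1, 3)) (f : {mpoly C[n.-1 * 2]}) : C :=
  mx_eval (col' ord_max y) f.

End Gaudin.

(* Main.v *)
Require Import Defs.
From HB Require Import structures.
From mathcomp Require Import all_boot all_order all_algebra.
From mathcomp Require Import boolp reals complex mpoly.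
From mathcomp Require Import ring.

(* On the PBW basis the matrix units act by explicit differential operators,   *)
(* except that [e_13], which occurs in the Casimir element only next to        *)
(* [e_31], i.e. to multiplication by [x_3], is not needed in degree 0. Hence   *)
(* the degree 0 part of [Omega^(ij) F] is                                      *)
(*   Omega_0^(ij) F_0                                                          *)
(*   + (x_1^(i) x_2^(j) - x_2^(i) x_1^(j))                                     *)
(*     * (d/dx_3^(i) F - d/dx_3^(j) F)_0,                                      *)
(* and on the diagonal the vectors [x_1] and [x_2] are proportional, so that   *)
(* each [(H_i)_0 F_0 - mu_i F_0] vanishes there.                               *)
(*                                                                             *)
(* For the differential equation, put [w_i = 1 / (y_1^(j) - z_i)]. Then        *)
(* [d/dy_k^(j) = sum_i w_i x_k^(i) d/dx_k^(i)], and [sum_i w_i x_k^(i) = 0]    *)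
(* since the generating function vanishes at [y_k^(j)]. As                     *)
(* [(w_i - w_k) / (z_i - z_k) = w_i w_k], the sum over [i] and [k] becomes     *)
(* [sum_(i,k) w_i w_k T_ik], where [Omega_0^(ik) = (La_i, La_k) + T_ik + T_ki],*)
(* and the second relation kills all the terms of [T_ik] that are not          *)
(* derivatives in [y].                                                         *)

(** The eigenvalue equation does not close on F_0: the operators [e_12] and [e_23] bring in the
    degree 1 component of F. By [deg0_casimir] it occurs only multiplied by a 2x2 minor of the pair
    of vectors x_1, x_2. These minors vanish where y_1 = y_2 ([xmx_proportional]), whence
    [deg0_eigen_vanish].

    The shape of the equations is an independent identity, [separated_form], valid for every
    polynomial whose values are u_1^l1 u_2^l2 f. It rests on [sum_symmetrize], [sum_separated] and
    the chain rules [deriv_xmx] and [deriv2_xmx]. In T_ik the second derivatives in the variables of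
    index i alone drop out and those mixing i and k survive with the opposite sign; hence the
    second-order part f_11 - f_12 + f_22, while the first-order terms carry a minus sign. *)

Set Implicit Arguments.
Unset Strict Implicit.
Unset Printing Implicit Defensive.

Import GRing.Theory Num.Theory.
Local Open Scope ring_scope.

(** * The action of sl_3 on the PBW basis *)

Section IteratedCommutators.
Variables (K : comNzRingType) (V : lmodType K).
Implicit Types (A C : V -> V) (B : {linear V -> V}).

Lemma iter_comm A B k x : (forall y, A (B y) = B (A y)) ->
  A (iter k B x) = iter k B (A x).
Proof. by move=> AB; elim: k => //= k IH; rewrite AB IH. Qed.

(** Each passage of [A] across one [B] leaves a [C], which slides freely to the right. At [k = 0]
    the truncated [k.-1] is harmless, its coefficient being 0. *)
Lemma iter_comm_central A B C k x :
    (forall y, A (B y) = B (A y) + C y) -> (forall y, C (B y) = B (C y)) ->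
  A (iter k B x) = iter k B (A x) + k%:R *: iter k.-1 B (C x).
Proof.
move=> AB CB; elim: k => [|k IH] /=; first by rewrite scale0r addr0.
rewrite AB IH linearD linearZ (iter_comm _ _ CB) -addrA; congr (_ + _).
by case: k {IH} => [|k] /=; rewrite ?scale0r ?add0r ?scale1r // -[in RHS]natr1 scalerDl scale1r.
Qed.

Lemma iter_shift C B (b c : K) k x :
    (forall y, C (B y) = B (C y) + b *: B y) -> C x = c *: x ->
  C (iter k B x) = (c + k%:R * b) *: iter k B x.
Proof.
move=> CB Cx; elim: k => [|k IH] /=; first by rewrite mul0r addr0.
by rewrite CB IH linearZ -scalerDl -natr1 mulrDl mul1r addrA.
Qed.

(** The sl_2 identity e f^k = f^k e + k f^(k-1) (h - k + 1), with [A], [B], [C] as e, f, h, applied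
    to an eigenvector of h. *)
Lemma iter_comm_shift A B C (c : K) k x :
    (forall y, A (B y) = B (A y) + C y) ->
    (forall y, C (B y) = B (C y) + (- 2%:R) *: B y) -> C x = c *: x ->
  A (iter k B x) = iter k B (A x) + (k%:R * (c - k.-1%:R)) *: iter k.-1 B x.
Proof.
move=> AB CB Cx; elim: k => [|k IH] /=; first by rewrite mul0r scale0r addr0.
rewrite AB IH linearD linearZ (iter_shift k CB Cx) -addrA; congr (_ + _).
case: k {IH} => [|k] /=; first by rewrite !mul0r scale0r add0r addr0 mul1r subr0.
by rewrite -scalerDl; congr (_ *: _); rewrite -!natr1; ring.
Qed.

Lemma sub_double (p q r : V) : p - r - (q + r) = p - q + (- 2%:R) *: r.
Proof. by rewrite scaleNr scaler_nat mulr2n !opprD addrACA. Qed.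

Lemma iter0 B k : iter k B 0 = 0.
Proof. by elim: k => //= k ->; rewrite linear0. Qed.

Lemma iterD B k x y : iter k B (x + y) = iter k B x + iter k B y.
Proof. by elim: k => //= k ->; rewrite linearD. Qed.

Lemma iterZ B k (a : K) x : iter k B (a *: x) = a *: iter k B x.
Proof. by elim: k => //= k ->; rewrite linearZ. Qed.

End IteratedCommutators.

(** * Traceless parts of the matrix units *)

Section Sl3.
Variable K : numFieldType.

(* sl3_act is unspecified on matrices of nonzero trace, so that the diagonal   *)
(* matrix units have to be made traceless.                                     *)
Definition unit_part (a b : 'I_3) : 'M[K]_3 :=
  delta_mx a b - ((a == b)%:R / 3%:R)%:M.

Lemma mxtrace_delta (a b : 'I_3) : \tr (delta_mx a b : 'M[K]_3) = (a == b)%:R.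
Proof.
rewrite /mxtrace (bigD1 a) //= mxE eqxx big1 ?addr0 // => k /negPf ka.
by rewrite mxE ka.
Qed.

Lemma mxtrace_unit_part a b : \tr (unit_part a b) = 0.
Proof.
rewrite raddfB /= mxtrace_delta mxtrace_scalar -[_ *+ 3]mulr_natr mulfVK ?subrr //.
by rewrite pnatr_eq0.
Qed.

Lemma unit_part_neq a b : a != b -> unit_part a b = delta_mx a b.
Proof. by rewrite /unit_part => /negPf ->; rewrite mul0r raddf0 subr0. Qed.

(** Scalar matrices are central, and the two scalars hidden on the right cancel, so removing traces
    preserves the gl_3 relations exactly. *)
Lemma unit_part_bracket a b c d :
  unit_part a b *m unit_part c d - unit_part c d *m unit_part a b
  = (b == c)%:R *: unit_part a d - (d == a)%:R *: unit_part c b.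
Proof.
rewrite /unit_part !mulmxBl !mulmxBr !mul_delta_mx_cond.
rewrite !mul_scalar_mx !mul_mx_scalar !scale_scalar_mx -!scaler_nat.
rewrite !scalerBr !scale_scalar_mx [a == d]eq_sym [c == b]eq_sym.
set x := delta_mx a d; set y := delta_mx c b; set p := _ *: delta_mx c d.
set q := _ *: delta_mx a b.
apply/matrixP => i j; rewrite !mxE.
by case: (b == c); case: (d == a); case: (i == j); rewrite /=; ring.
Qed.

End Sl3.

Section TracelessRepresentation.
Variables (K : numFieldType) (V : lmodType K) (rho : 'M[K]_3 -> {linear V -> V}).
Hypothesis rho_linear : forall k A B x, \tr A = 0 -> \tr B = 0 ->
  rho (k *: A + B) x = k *: rho A x + rho B x.
Hypothesis rho_bracket : forall A B x, \tr A = 0 -> \tr B = 0 ->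
  rho (A *m B - B *m A) x = rho A (rho B x) - rho B (rho A x).

Lemma rho_unit_bracket a b c d x :
  rho (unit_part K a b) (rho (unit_part K c d) x)
    - rho (unit_part K c d) (rho (unit_part K a b) x)
  = (b == c)%:R *: rho (unit_part K a d) x - (d == a)%:R *: rho (unit_part K c b) x.
Proof.
have tr0 := mxtrace_unit_part K.
have rho0 : rho 0 x = 0.
  have := @rho_linear (-1) 0 0 x (raddf0 _) (raddf0 _).
  by rewrite scaler0 addr0 scaleN1r addNr.
have rhoZ k A : \tr A = 0 -> rho (k *: A) x = k *: rho A x.
  by move=> trA; rewrite -[k *: A]addr0 rho_linear ?raddf0 // rho0 addr0.
rewrite -rho_bracket // unit_part_bracket -!scaleNr.
by rewrite rho_linear ?rhoZ // mxtraceZ tr0 mulr0.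
Qed.

Lemma unit_part_diag a :
  unit_part K a a = diag_mx (\row_k ((k == a)%:R - 3%:R^-1)).
Proof.
apply/matrixP => i k; rewrite !mxE eqxx div1r.
have [<-|ik] := eqVneq i k; first by rewrite andbb !mulr1n.
rewrite !mulr0n subr0; case: (i =P a) => [<-|//].
by rewrite eq_sym (negPf ik).
Qed.

Variables (v : V) (la : 'rV[K]_3).
Hypothesis la_sum : \sum_k la 0 k = 0.
Hypothesis rho_diag : forall d : 'rV[K]_3, \sum_k d 0 k = 0 ->
  rho (diag_mx d) v = (\sum_k la 0 k * d 0 k) *: v.

(** The correction by 1/3 of the identity pairs with [la] to a multiple of the sum of its entries,
    which is 0. *)
Lemma rho_unit_diag a : rho (unit_part K a a) v = la 0 a *: v.
Proof.
rewrite unit_part_diag rho_diag.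
  congr (_ *: _); under eq_bigr do rewrite mxE mulrBr.
  rewrite sumrB -mulr_suml la_sum mul0r subr0 (bigD1 a) //= eqxx mulr1.
  by rewrite big1 ?addr0 // => k /negPf ka; rewrite ka mulr0.
under eq_bigr do rewrite mxE.
rewrite sumrB (bigD1 a) //= eqxx [X in _ + X - _]big1 => [|k /negPf -> //].
by rewrite addr0 sumr_const card_ord -[_ *+ 3]mulr_natl mulfV ?subrr // pnatr_eq0.
Qed.

End TracelessRepresentation.

(* Operators e a b obeying the commutation relations of the matrix units of    *)
(* gl_3; those of sl_3 come from the traceless parts [unit_part a b].          *)
Section PBW.
Variables (K : comNzRingType) (V : lmodType K).
Variable e : 'I_3 -> 'I_3 -> {linear V -> V}.
Hypothesis e_bracket : forall a b c d x,
  e a b (e c d x) - e c d (e a b x)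
  = (b == c)%:R *: e a d x - (d == a)%:R *: e c b x.
Variables (v : V) (la : 'rV[K]_3).
Hypothesis e_raise : forall a b : 'I_3, (a < b)%N -> e a b v = 0.
Hypothesis e_diag : forall a, e a a v = la 0 a *: v.

Let e_comm a b c d x : e a b (e c d x)
  = e c d (e a b x) + ((b == c)%:R *: e a d x - (d == a)%:R *: e c b x).
Proof. by rewrite -e_bracket addrC subrK. Qed.

Definition pbw (j1 j3 j2 : nat) : V :=
  iter j1 (e 1 0) (iter j3 (e 2 0) (iter j2 (e 2 1) v)).

Lemma pbw_e10 j1 j3 j2 : e 1 0 (pbw j1 j3 j2) = pbw j1.+1 j3 j2.
Proof. by []. Qed.

Lemma pbw_e20 j1 j3 j2 : e 2 0 (pbw j1 j3 j2) = pbw j1 j3.+1 j2.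
Proof.
rewrite /pbw iter_comm // => y.
by rewrite e_comm /= !scale0r subrr addr0.
Qed.

Lemma pbw_e21 j1 j3 j2 :
  e 2 1 (pbw j1 j3 j2) = pbw j1 j3 j2.+1 + j1%:R *: pbw j1.-1 j3.+1 j2.
Proof.
rewrite /pbw (iter_comm_central (C := e 2 0)) => [|y|y]; first last.
- by rewrite e_comm /= !scale0r subrr addr0.
- by rewrite e_comm /= !scale0r subr0 scale1r.
rewrite (iter_comm (A := e 2 1)) // => y.
by rewrite e_comm /= !scale0r subrr addr0.
Qed.

(** Moving right, [e 1 2] commutes with [e 1 0], turns one [e 2 0] into [e 1 0], forms an sl_2
    triple with [e 2 1] and kills [v]. *)
Lemma pbw_e12 j1 j3 j2 :
  e 1 2 (pbw j1 j3 j2)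
  = j3%:R *: pbw j1.+1 j3.-1 j2
    + (j2%:R * (la 0 1 - la 0 2 - j2.-1%:R)) *: pbw j1 j3 j2.-1.
Proof.
rewrite /pbw iter_comm => [|y]; last first.
  by rewrite e_comm /= !scale0r subrr addr0.
rewrite (iter_comm_central (C := e 1 0)) => [|y|y]; first last.
- by rewrite e_comm /= !scale0r subrr addr0.
- by rewrite e_comm /= scale0r subr0 scale1r.
rewrite (iter_comm_shift (C := e 1 1 \- e 2 2) (c := la 0 1 - la 0 2)).
- rewrite e_raise // iter0 add0r addrC !(iterD, iterZ); congr (_ *: _ + _).
  rewrite -(iter_comm (A := e 1 0)) => [|y]; first by rewrite -iterSr.
  by rewrite e_comm /= !scale0r subrr addr0.
- by move=> y; rewrite e_comm /= !scale1r.
- move=> y /=; rewrite (e_comm 1 1 2 1) (e_comm 2 2 2 1) /= !scale0r !scale1r subr0 sub0r.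
  by rewrite [in RHS]linearB /=; apply: sub_double.
- by rewrite /= !e_diag scalerBl.
Qed.

Lemma pbw_ediag a j1 j3 j2 :
  e a a (pbw j1 j3 j2)
  = (la 0 a - j1%:R * ((a == 0)%:R - (a == 1)%:R)
            - j3%:R * ((a == 0)%:R - (a == 2)%:R)
            - j2%:R * ((a == 1)%:R - (a == 2)%:R)) *: pbw j1 j3 j2.
Proof.
have sh (c d : 'I_3) y : e a a (e c d y)
    = e c d (e a a y) + ((a == c)%:R - (a == d)%:R) *: e c d y.
  rewrite e_comm scalerBl [d == a]eq_sym; congr (_ + (_ - _)).
    by case: eqP => [->|] //; rewrite !scale0r.
  by case: eqP => [->|] //; rewrite !scale0r.
have act2 := iter_shift j2 (sh 2 1) (e_diag a).
have act3 := iter_shift j3 (sh 2 0) act2.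
by rewrite /pbw (iter_shift j1 (sh 1 0) act3); congr (_ *: _); ring.
Qed.

(** Here [e 0 1] and [e 1 0] form the sl_2 triple, acting on a vector whose weight for
    [e 0 0 - e 1 1] has been shifted by [j2 - j3]; past [e 2 0] the commutator is [- e 2 1]. *)
Lemma pbw_e01 j1 j3 j2 :
  e 0 1 (pbw j1 j3 j2)
  = (j1%:R * (la 0 0 - la 0 1 + j2%:R - j3%:R - j1.-1%:R)) *: pbw j1.-1 j3 j2
    - j3%:R *: pbw j1 j3.-1 j2.+1.
Proof.
rewrite {1}/pbw (iter_comm_shift (C := e 0 0 \- e 1 1)
  (c := la 0 0 - la 0 1 + j2%:R - j3%:R)).
- rewrite addrC; congr (_ + _).
  rewrite (iter_comm_central (C := fun x => -1 *: e 2 1 x)) => [|y|y]; first last.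
  + by rewrite e_comm /= !scale0r subrr addr0 linearZ.
  + by rewrite e_comm /= scale0r sub0r scaleN1r scale1r.
  rewrite iter_comm => [|y]; last by rewrite e_comm /= !scale0r subrr addr0.
  by rewrite e_raise // !iter0 add0r !iterZ scalerA mulrN1 scaleNr.
- by move=> y; rewrite e_comm /= !scale1r.
- move=> y /=; rewrite (e_comm 0 0 1 0) (e_comm 1 1 1 0) /= !scale0r !scale1r subr0 sub0r.
  by rewrite [in RHS]linearB /=; apply: sub_double.
- have act a := pbw_ediag a 0 j3 j2; rewrite /pbw /= in act.
  by rewrite /= !act -scalerBl /=; congr (_ *: _); ring.
Qed.

End PBW.

(** * Transfer to polynomials *)

Lemma mxvec_index_eq m n (i i' : 'I_m) (j j' : 'I_n) :
  (mxvec_index i j == mxvec_index i' j') = (i == i') && (j == j').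
Proof.
rewrite /mxvec_index (inj_eq (@cast_ord_inj _ _ _)) (inj_eq enum_rank_inj).
by rewrite xpair_eqE.
Qed.

Lemma mderivXU N (K : comNzRingType) (i j : 'I_N) :
  ('X_i : {mpoly K[N]})^`M(j) = (i == j)%:R.
Proof.
rewrite mderivX mnm1E; case: eqP => [->|_]; last by rewrite scale0r.
rewrite scale1r -mpolyX0; congr 'X_[_]; apply/mnmP => k.
by rewrite mnmBE subnn mnm0E.
Qed.

Lemma mpolyX_mderivX N (K : comNzRingType) (i : 'I_N) (m : 'X_{1..N}) :
  'X_i * ('X_[m] : {mpoly K[N]})^`M(i) = (m i)%:R *: 'X_[m].
Proof.
rewrite mderivX -scalerAr -mpolyXD; case: (posnP (m i)) => [->|mi_gt0].
  by rewrite !scale0r.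
congr (_ *: 'X_[_]); apply/mnmP => k; rewrite mnmDE mnmBE mnm1E.
by case: eqP => [<-|_]; rewrite ?subnKC // subn0.
Qed.

Section Operators.
Variables (K : comNzRingType) (n : nat).
Implicit Types (p q : {mpoly K[n * 3]}) (i : 'I_n) (k a b : 'I_3).

Local Notation X i k := ('X_(xvar i k) : {mpoly K[n * 3]}).
Local Notation D i k p := (p^`M(xvar i k)).

Definition euler i k p := X i k * D i k p.

(* [opab] is the action of the matrix unit of formal indices [a], [b], where   *)
(* [c] is the weight of the highest weight vector for [e_aa - e_bb].           *)
Definition op01 (c : K) i p := c *: D i 0 p
  + euler i 1 (D i 0 p) - euler i 2 (D i 0 p) - euler i 0 (D i 0 p)
  - X i 1 * D i 2 p.

Definition op12 (c : K) i p :=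
  c *: D i 1 p - euler i 1 (D i 1 p) + X i 0 * D i 2 p.

Definition op21 i p := X i 1 * p + X i 2 * D i 0 p.

Definition opdiag (la : 'rV[K]_3) a i p := la 0 a *: p
  - ((a == 0)%:R - (a == 1)%:R) *: euler i 0 p
  - ((a == 0)%:R - (a == 2)%:R) *: euler i 2 p
  - ((a == 1)%:R - (a == 2)%:R) *: euler i 1 p.

(** Reduces an identity of linear operators to monomials. Linearity is an unbundled hypothesis, so
    that composite expressions can be used without packing them. *)
Lemma mpoly_linear_ext (W : lmodType K) (g h : {mpoly K[n * 3]} -> W) :
  linear g -> linear h -> (forall m, g 'X_[m] = h 'X_[m]) -> g =1 h.
Proof.
move=> g_lin h_lin gh p.
pose g' := GRing.isLinear.Build _ _ _ _ g g_lin.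
pose h' := GRing.isLinear.Build _ _ _ _ h h_lin.
pose gL : {linear _ -> _} := HB.pack g g'.
pose hL : {linear _ -> _} := HB.pack h h'.
rewrite -[g]/(gL : _ -> _) -[h]/(hL : _ -> _) [p]mpolyE !linear_sum.
by apply: eq_bigr => m _; rewrite !linearZ /= gh.
Qed.

Lemma xvar_eq i j k l : (@xvar n i k == xvar j l) = (i == j) && (k == l).
Proof. exact: mxvec_index_eq. Qed.

Section Transfer.
Variables (V : 'I_n -> lmodType K) (T : lmodType K) (t : (forall i, V i) -> T).
Hypothesis t_lin : forall (w : forall i, V i) i (c : K) (x y : V i),
  t (dfwith w (c *: x + y)) = c *: t (dfwith w x) + t (dfwith w y).
Variable e : forall i, 'I_3 -> 'I_3 -> {linear V i -> V i}.
Hypothesis e_bracket : forall i a b c d x,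
  e i a b (e i c d x) - e i c d (e i a b x)
  = (b == c)%:R *: e i a d x - (d == a)%:R *: e i c b x.
Variables (v : forall i, V i) (la : 'I_n -> 'rV[K]_3).
Hypothesis e_raise : forall i (a b : 'I_3), (a < b)%N -> e i a b (v i) = 0.
Hypothesis e_diag : forall i a, e i a a (v i) = la i 0 a *: v i.
Variable E : 'I_n -> 'I_3 -> 'I_3 -> {linear T -> T}.
Hypothesis E_t : forall i a b w, E i a b (t w) = t (dfwith w (e i a b (w i))).
Variable Phi : {linear {mpoly K[n * 3]} -> T}.

Let vec (m : 'X_{1..n * 3}) i : V i :=
  pbw (e i) (v i) (m (xvar i 0)) (m (xvar i 2)) (m (xvar i 1)).

Hypothesis Phi_t : forall m : 'X_{1..n * 3}, Phi 'X_[m] = t (vec m).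

Let t_0 w i : t (dfwith w (0 : V i)) = 0.
Proof.
have := t_lin w 1 (0 : V i) 0; rewrite scaler0 addr0 scale1r => /eqP.
by rewrite -subr_eq subrr eq_sym => /eqP.
Qed.

Let t_D w i (x y : V i) : t (dfwith w (x + y)) = t (dfwith w x) + t (dfwith w y).
Proof. by rewrite -[x]scale1r t_lin !scale1r. Qed.

Let t_Z w i (c : K) (x : V i) : t (dfwith w (c *: x)) = c *: t (dfwith w x).
Proof. by rewrite -[c *: x]addr0 t_lin t_0 addr0. Qed.

(** Operators in the i-th factor change only the exponents of the variables x^(i); the other tensor
    factors are read off from either monomial. *)
Let t_vec i (m m' : 'X_{1..n * 3}) (x : V i) :
    (forall j k, (i == j) = false -> m' (xvar j k) = m (xvar j k)) -> x = vec m' i ->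
  t (dfwith (vec m) x) = Phi 'X_[m'].
Proof.
move=> mm' ->; rewrite Phi_t; congr t; apply: functional_extensionality_dep => j.
case: dfwithP => // {}j /negPf ij.
by rewrite /vec !mm'.
Qed.

Ltac off_factor := let ij := fresh in intros ? ? ij;
  by rewrite ?mnmDE ?mnmBE ?mnm1E ?xvar_eq ?ij ?andFb ?subn0 ?add0n.
Ltac on_factor :=
  by rewrite /vec ?mnmDE ?mnmBE ?mnm1E ?xvar_eq ?eqxx /= ?subn0 ?add0n ?add1n ?addn0 ?subn1.

Lemma transfer_10 i p : E i 1 0 (Phi p) = Phi (X i 0 * p).
Proof.
move: p; apply: mpoly_linear_ext => [c x y|c x y|m].
- by rewrite !linearP.
- by rewrite mulrDr -scalerAr linearP.
rewrite Phi_t E_t pbw_e10 -mpolyXD.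
apply: t_vec; [off_factor | on_factor].
Qed.

Lemma transfer_20 i p : E i 2 0 (Phi p) = Phi (X i 2 * p).
Proof.
move: p; apply: mpoly_linear_ext => [c x y|c x y|m].
- by rewrite !linearP.
- by rewrite mulrDr -scalerAr linearP.
rewrite Phi_t E_t pbw_e20 // -mpolyXD.
apply: t_vec; [off_factor | on_factor].
Qed.

Lemma transfer_21 i p : E i 2 1 (Phi p) = Phi (op21 i p).
Proof.
move: p; apply: mpoly_linear_ext => [c x y|c x y|m].
- by rewrite !linearP.
- by rewrite /op21 !linearP !mulrDr -!scalerAr addrACA -scalerDr linearP.
rewrite Phi_t E_t pbw_e21 // t_D t_Z /op21 mderivX -scalerAr -!mpolyXD linearD linearZ.
congr (_ + _ *: _); apply: t_vec; [off_factor | on_factor| off_factor | on_factor].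
Qed.

Lemma transfer_12 i p :
  E i 1 2 (Phi p) = Phi (op12 (la i 0 1 - la i 0 2) i p).
Proof.
move: p; apply: mpoly_linear_ext => [c x y|c x y|m].
- by rewrite !linearP.
- rewrite /op12 /euler -linearP /=; congr (Phi _); rewrite !linearP /=.
  by rewrite -!mul_mpolyC; ring.
rewrite Phi_t E_t (pbw_e12 (@e_bracket i) (@e_raise i) (@e_diag i)).
rewrite t_D !t_Z /op12 /euler !mderivX !mderivZ -!scalerAr mpolyX_mderivX.
rewrite -!mpolyXD addrC !scalerA -scalerBl linearD !linearZ /=.
congr (_ *: _ + _ *: _).
(* [euler] acts after the derivative and so counts an exponent already lowered by one: this is the
   [j2.-1] of the sl_2 identity. *)
- by rewrite mnmBE mnm1E eqxx subn1; ring.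
- by apply: t_vec; [off_factor | on_factor].
- by apply: t_vec; [off_factor | on_factor].
Qed.

Lemma transfer_01 i p :
  E i 0 1 (Phi p) = Phi (op01 (la i 0 0 - la i 0 1) i p).
Proof.
move: p; apply: mpoly_linear_ext => [c x y|c x y|m].
- by rewrite !linearP.
- rewrite /op01 /euler -linearP /=; congr (Phi _); rewrite !linearP /=.
  by rewrite -!mul_mpolyC; ring.
rewrite Phi_t E_t (pbw_e01 (@e_bracket i) (@e_raise i) (@e_diag i)).
rewrite -scaleNr t_D !t_Z /op01 /euler !mderivX !mderivZ -!scalerAr !mpolyX_mderivX.
rewrite -!mpolyXD !scalerA -scalerDl -!scalerBl -scaleNr linearD !linearZ /=.
congr (_ *: _ + _ *: _).
- by rewrite !mnmBE !mnm1E !xvar_eq !eqxx /= subn1 !subn0; ring.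
- by apply: t_vec; [off_factor | on_factor].
- by apply: t_vec; [off_factor | on_factor].
Qed.

Lemma transfer_diag i a p : E i a a (Phi p) = Phi (opdiag (la i) a i p).
Proof.
move: p; apply: mpoly_linear_ext => [c x y|c x y|m].
- by rewrite !linearP.
- rewrite -linearP; congr (Phi _); rewrite /opdiag /euler !linearP /=.
  by rewrite -!mul_mpolyC; ring.
rewrite Phi_t E_t (pbw_ediag (@e_bracket i) (@e_diag i)).
rewrite t_Z /opdiag /euler !mpolyX_mderivX !scalerA -!scalerBl linearZ /=.
congr (_ *: _); first by ring.
by apply: t_vec; [off_factor | on_factor].
Qed.

End Transfer.
End Operators.

Section FactorAction.
Variables (K : comNzRingType) (n : nat) (V : 'I_n -> lmodType K) (T : lmodType K).
Variables (t : (forall i, V i) -> T).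
Hypothesis t_lin : forall (w : forall i, V i) i (c : K) (x y : V i),
  t (dfwith w (c *: x + y)) = c *: t (dfwith w x) + t (dfwith w y).
Variable rho : forall i, 'M[K]_3 -> {linear V i -> V i}.
Hypothesis rho_linear : forall i k A B (x : V i), \tr A = 0 -> \tr B = 0 ->
  rho i (k *: A + B) x = k *: rho i A x + rho i B x.
Variable act : 'I_n -> 'M[K]_3 -> {linear T -> T}.
Hypothesis act_t : forall i A w, \tr A = 0 ->
  act i A (t w) = t (dfwith w (rho i A (w i))).
Variable Phi : {linear {mpoly K[n * 3]} -> T}.
Hypotheses (Phi_bij : bijective Phi)
  (Phi_pure : forall m : 'X_{1..n * 3}, exists w, Phi 'X_[m] = t w).

(** [act] is prescribed on pure tensors only. Monomials go to pure tensors and [Phi] is onto, so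
    linearity in the matrix spreads to all of [T]. *)
Lemma factor_act_linear i k A B x : \tr A = 0 -> \tr B = 0 ->
  act i (k *: A + B) x = k *: act i A x + act i B x.
Proof.
move=> trA trB; have [Psi _ PsiK] := Phi_bij; rewrite -(PsiK x).
move: (Psi x); apply: mpoly_linear_ext => [c p q|c p q|m].
- by rewrite !linearP.
- by rewrite !linearP /= addrACA !scalerA mulrC.
have trAB : \tr (k *: A + B) = 0 by rewrite raddfD /= mxtraceZ trA trB mulr0 addr0.
by have [w ->] := Phi_pure m; rewrite !act_t // rho_linear // t_lin.
Qed.

End FactorAction.

(** * The degree 0 part of the Casimir operator *)

Section Degree0.
Variables (K : comNzRingType) (n : nat).
Implicit Types (p q : {mpoly K[n * 3]}) (i j : 'I_n) (k a b : 'I_3).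

Local Notation X i k := ('X_(xvar i k) : {mpoly K[n * 3]}).
Local Notation D i k p := (p^`M(xvar i k)).

(* [degree_part 0] over an arbitrary ring; likewise [omega0], [mxeval] and     *)
(* [xmx] below stand for [Omega0], [mx_eval] and [xcoord].                     *)
Definition deg0 p : {mpoly K[n * 3]} :=
  \sum_(m <- msupp p | (\sum_i m (xvar i 2%R))%N == 0%N) p@_m *: 'X_[m].

Lemma mcoeff_deg0 p (m : 'X_{1..n * 3}) :
  (deg0 p)@_m = p@_m *+ ((\sum_i m (xvar i 2%R))%N == 0%N).
Proof.
rewrite [in RHS](mpolyE p) /deg0 !raddf_sum -sumrMnl big_mkcond; apply: eq_bigr => m' _.
rewrite /= mcoeffZ mcoeffX; case: (m' =P m) => [->|_].
  by case: ifP => _; rewrite ?mcoeffZ ?mcoeffX ?eqxx.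
by case: ifP => _; rewrite ?mcoeffZ ?mcoeffX; case: eqP; rewrite ?mulr0 ?mul0rn ?mcoeff0.
Qed.

Lemma deg0_is_linear : linear deg0.
Proof.
move=> c p q; apply/mpolyP => m.
by rewrite !(mcoeffD, mcoeffZ, mcoeff_deg0) mulrnDl mulrnAr.
Qed.

HB.instance Definition _ :=
  GRing.isLinear.Build K {mpoly K[n * 3]} {mpoly K[n * 3]} _ deg0 deg0_is_linear.

Lemma deg0D : {morph deg0 : p q / p + q}.
Proof. exact: linearD. Qed.

Lemma deg0Z (c : K) p : deg0 (c *: p) = c *: deg0 p.
Proof. exact: linearZ. Qed.

Lemma deg0X (m : 'X_{1..n * 3}) :
  deg0 'X_[m] = 'X_[m] *+ ((\sum_i m (xvar i 2%R))%N == 0%N).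
Proof.
apply/mpolyP => m'; rewrite mcoeff_deg0 mcoeffMn mcoeffX.
by case: eqP => [->|] //; rewrite !mul0rn.
Qed.

(** This disposes of every Casimir term containing [e_31], whatever its partner [e_13] does. *)
Lemma deg0_X2 i p : deg0 (X i 2 * p) = 0.
Proof.
move: p; apply: mpoly_linear_ext => [c x y|c x y|m].
- by rewrite mulrDr -scalerAr linearP.
- by rewrite scaler0 addr0.
rewrite -mpolyXD deg0X (bigD1 i) //= mnmDE mnm1E eqxx add1n addSn.
by rewrite mulr0n.
Qed.

Lemma deg0_X i k p : k != 2 -> deg0 (X i k * p) = X i k * deg0 p.
Proof.
move=> k2; move: p; apply: mpoly_linear_ext => [c x y|c x y|m].
- by rewrite mulrDr -scalerAr linearP.
- by rewrite linearP mulrDr -scalerAr.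
rewrite -mpolyXD !deg0X mulrnAr -mpolyXD; congr (_ *+ (_ == _)).
by apply: eq_bigr => j _; rewrite mnmDE mnm1E xvar_eq (negPf k2) andbF.
Qed.

Lemma deg0_D i k p : k != 2 -> deg0 (D i k p) = D i k (deg0 p).
Proof.
move=> k2; apply/mpolyP => m; rewrite mcoeff_deg0 !mcoeff_deriv mcoeff_deg0.
rewrite mulrnAC; congr (_ *+ nat_of_bool (_ == _) *+ _).
by apply: eq_bigr => j _; rewrite mnmDE mnm1E xvar_eq (negPf k2) andbF addn0.
Qed.

Lemma deg0_euler i k p : k != 2 -> deg0 (euler i k p) = euler i k (deg0 p).
Proof. by move=> k2; rewrite /euler deg0_X // deg0_D. Qed.

Lemma deg0_euler2 i p : deg0 (euler i 2 p) = 0.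
Proof. exact: deg0_X2. Qed.

(** The derivative in x_3 lowers the degree, so [deg0 (D i 2 p)] is contributed by the degree 1
    component of [p]; it is the only term not determined by [deg0 p]. *)
Lemma deg0_op01 (c : K) i p :
  deg0 (op01 c i p) = c *: D i 0 (deg0 p) + euler i 1 (D i 0 (deg0 p))
    - euler i 0 (D i 0 (deg0 p)) - X i 1 * deg0 (D i 2 p).
Proof.
rewrite /op01 !(linearB, linearD, linearZ_LR) /= deg0_euler2 subr0.
by rewrite deg0_X // !deg0_euler // (@deg0_D i 0).
Qed.

Lemma deg0_op12 (c : K) i p :
  deg0 (op12 c i p) = c *: D i 1 (deg0 p) - euler i 1 (D i 1 (deg0 p))
    + X i 0 * deg0 (D i 2 p).
Proof.
rewrite /op12 !(linearB, linearD, linearZ_LR) /= deg0_X // !deg0_euler //.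
by rewrite (@deg0_D i 1).
Qed.

Lemma deg0_op21 i p : deg0 (op21 i p) = X i 1 * deg0 p.
Proof. by rewrite /op21 linearD /= deg0_X2 addr0 deg0_X. Qed.

Lemma deg0_opdiag (la : 'rV[K]_3) a i p :
  deg0 (opdiag la a i p) = la 0 a *: deg0 p
    - ((a == 0)%:R - (a == 1)%:R) *: euler i 0 (deg0 p)
    - ((a == 1)%:R - (a == 2)%:R) *: euler i 1 (deg0 p).
Proof.
rewrite /opdiag !linearB !linearZ_LR /= deg0_euler2 oppr0 scaler0 addr0.
by rewrite !deg0_euler.
Qed.

Definition omega0 (c a1 b1 a2 b2 : K) i j p : {mpoly K[n * 3]} :=
  let dd k p := D i k p - D j k p in
  c *: p
  + (X j 0 * X i 1 * D i 1 (dd 0 p) - X i 0 * X j 1 * D j 1 (dd 0 p))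
  - X i 0 * X j 0 * dd 0 (dd 0 p)
  - X i 1 * X j 1 * dd 1 (dd 1 p)
  + (a1 *: X j 0 - b1 *: X i 0) * dd 0 p
  + (a2 *: X j 1 - b2 *: X i 1) * dd 1 p.

Lemma sum_I3 (V : nmodType) (g : 'I_3 -> V) : \sum_a g a = g 0 + g 1 + g 2.
Proof.
rewrite !big_ord_recr big_ord0 /= add0r.
by congr (g _ + g _ + g _); apply: val_inj.
Qed.

(** The derivatives in x_3 enter once from each of the four terms [op01] and [op12], with signs that
    assemble into the minor of x_1, x_2 at i, j. Since i and j differ, they pass through the
    operators of the other factor. *)
Lemma deg0_casimir (la nu : 'rV[K]_3) i j p : i != j ->
  \sum_a deg0 (opdiag la a i (opdiag nu a j p))
  + deg0 (op01 (la 0 0 - la 0 1) i (X j 0 * p))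
  + deg0 (X i 0 * op01 (nu 0 0 - nu 0 1) j p)
  + deg0 (op12 (la 0 1 - la 0 2) i (op21 j p))
  + deg0 (op21 i (op12 (nu 0 1 - nu 0 2) j p))
  = omega0 (\sum_a la 0 a * nu 0 a) (la 0 0 - la 0 1) (nu 0 0 - nu 0 1)
      (la 0 1 - la 0 2) (nu 0 1 - nu 0 2) i j (deg0 p)
    + (X i 0 * X j 1 - X i 1 * X j 0) * (deg0 (D i 2 p) - deg0 (D j 2 p)).
Proof.
move=> ij; have ji : j != i by rewrite eq_sym.
have D2X : deg0 (D i 2 (X j 0 * p)) = X j 0 * deg0 (D i 2 p).
  by rewrite mderivM mderivXU xvar_eq (negPf ji) mul0r add0r deg0_X.
have D2op : deg0 (D i 2 (op21 j p)) = X j 1 * deg0 (D i 2 p).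
  rewrite /op21 mderivD !mderivM !mderivXU !xvar_eq (negPf ji) !mul0r !add0r.
  by rewrite linearD /= deg0_X2 addr0 deg0_X.
rewrite sum_I3 !deg0_opdiag !deg0_op21 deg0_X // !deg0_op01 !deg0_op12 D2X D2op.
rewrite deg0_op21 deg0_X //.
move: (deg0 p) (deg0 (D i 2 p)) (deg0 (D j 2 p)) => q ri rj.
rewrite /omega0 /euler /= sum_I3.
rewrite !(mderivM, mderivB, mderivD, mderivZ, mderivXU, xvar_eq).
rewrite ?eqxx ?(negPf ij) ?(negPf ji) /= ?mderiv0.
rewrite (mderiv_comm (xvar i 0) (xvar j 0) q) (mderiv_comm (xvar i 1) (xvar j 1) q).
rewrite (mderiv_comm (xvar j 1) (xvar i 0) q).
rewrite -!mul_mpolyC.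
ring.
Qed.

End Degree0.

(** * The Casimir element in terms of matrix units *)

Section OrthonormalBasis.
Variables (K : numFieldType) (I : finType) (X : I -> 'M[K]_3).
Hypothesis X_tr : forall c, \tr (X c) = 0.
Hypothesis X_orth : forall c d, \tr (X c *m X d) = (c == d)%:R.
Hypothesis X_span : forall A, \tr A = 0 -> exists c, A = \sum_d c d *: X d.
Variables (T : lmodType K) (beta : 'M[K]_3 -> 'M[K]_3 -> T).
Hypothesis betaL : forall k A B M, \tr A = 0 -> \tr B = 0 -> \tr M = 0 ->
  beta (k *: A + B) M = k *: beta A M + beta B M.
Hypothesis betaR : forall k A B M, \tr A = 0 -> \tr B = 0 -> \tr M = 0 ->
  beta M (k *: A + B) = k *: beta M A + beta M B.

(** By orthonormality the coefficient of [X c] is the trace of [unit_part K b a *m X c], which picks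
    out the entry (a, b) of the traceless matrix [X c]. *)
Lemma unit_part_expand a b : unit_part K b a = \sum_c X c a b *: X c.
Proof.
have [c cE] := X_span (mxtrace_unit_part K b a).
rewrite [LHS]cE; apply: eq_bigr => d _; congr (_ *: _).
have : \tr (unit_part K b a *m X d) = c d.
  rewrite cE mulmx_suml raddf_sum (bigD1 d) //= -scalemxAl mxtraceZ X_orth.
  rewrite eqxx mulr1 big1 ?addr0 // => k /negPf kd.
  by rewrite -scalemxAl mxtraceZ X_orth kd mulr0.
move<-; rewrite mulmxBl mul_scalar_mx raddfB /= mxtraceZ X_tr mulr0 subr0.
rewrite mxtrace_mulC /mxtrace (bigD1 a) //= big1 ?addr0 => [|k /negPf ka].
  rewrite mxE (bigD1 b) //= big1 => [|k /negPf kb]; last by rewrite !mxE kb mulr0.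
  by rewrite !mxE !eqxx mulr1 addr0.
by rewrite mxE big1 // => l _; rewrite !mxE ka andbF mulr0.
Qed.

Lemma traceless_expand A : \tr A = 0 ->
  A = \sum_a \sum_b A a b *: unit_part K a b.
Proof.
move=> trA; rewrite [LHS]matrix_sum_delta.
under [RHS]eq_bigr do (under eq_bigr do rewrite scalerBr; rewrite sumrB).
rewrite sumrB [X in _ - X](_ : _ = 0) ?subr0 //.
have inner a : \sum_b A a b *: ((a == b)%:R / 3%:R)%:M = A a a *: (3%:R^-1)%:M :> 'M[K]_3.
  rewrite (bigD1 a) //= eqxx div1r big1 ?addr0 // => b ba.
  by rewrite eq_sym (negPf ba) mul0r raddf0 scaler0.
rewrite (eq_bigr _ (fun a _ => inner a)) -scaler_suml -/(mxtrace A) trA.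
by rewrite scale0r.
Qed.

Let beta0L M : \tr M = 0 -> beta 0 M = 0.
Proof.
move=> trM; have := betaL (-1) (raddf0 _) (raddf0 _) trM.
by rewrite scaler0 addr0 scaleN1r addNr.
Qed.

Let beta0R M : \tr M = 0 -> beta M 0 = 0.
Proof.
move=> trM; have := betaR (-1) (raddf0 _) (raddf0 _) trM.
by rewrite scaler0 addr0 scaleN1r addNr.
Qed.

Let trsum (J : Type) (r : seq J) (c : J -> K) (A : J -> 'M[K]_3) :
  (forall j, \tr (A j) = 0) -> \tr (\sum_(j <- r) c j *: A j) = 0.
Proof. by move=> trA; rewrite raddf_sum big1 // => j _; rewrite /= mxtraceZ trA mulr0. Qed.

Let beta_sumL (J : Type) (r : seq J) (c : J -> K) (A : J -> 'M[K]_3) M :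
    (forall j, \tr (A j) = 0) -> \tr M = 0 ->
  beta (\sum_(j <- r) c j *: A j) M = \sum_(j <- r) c j *: beta (A j) M.
Proof.
move=> trA trM; elim: r => [|j r IH]; first by rewrite !big_nil beta0L.
by rewrite !big_cons betaL ?IH ?trsum.
Qed.

Let beta_sumR (J : Type) (r : seq J) (c : J -> K) (A : J -> 'M[K]_3) M :
    (forall j, \tr (A j) = 0) -> \tr M = 0 ->
  beta M (\sum_(j <- r) c j *: A j) = \sum_(j <- r) c j *: beta M (A j).
Proof.
move=> trA trM; elim: r => [|j r IH]; first by rewrite !big_nil beta0R.
by rewrite !big_cons betaR ?IH ?trsum.
Qed.

(** The entry [X c a b] is at once the coefficient of [unit_part K a b] in [X c] and that of [X c]
    in [unit_part K b a]; expanding one slot and recollecting the other changes the basis. *)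
Lemma casimir_unit_part :
  \sum_c beta (X c) (X c) = \sum_a \sum_b beta (unit_part K a b) (unit_part K b a).
Proof.
rewrite pair_big /=.
under [RHS]eq_bigr => ab _.
  rewrite (unit_part_expand ab.1 ab.2) beta_sumR ?mxtrace_unit_part //; over.
rewrite exchange_big /=; apply: eq_bigr => c _.
rewrite -beta_sumL // => [|ab]; last exact: mxtrace_unit_part.
by congr (beta _ _); rewrite {1}(traceless_expand (X_tr c)) pair_big.
Qed.

End OrthonormalBasis.

(** * The eigenvalue equation in degree 0 *)

Section CasimirDegree0.
Variables (K : comNzRingType) (n : nat).
Variables (V : 'I_n -> lmodType K) (T : lmodType K) (t : (forall i, V i) -> T).
Hypothesis t_lin : forall (w : forall i, V i) i (c : K) (x y : V i),
  t (dfwith w (c *: x + y)) = c *: t (dfwith w x) + t (dfwith w y).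
Variable e : forall i, 'I_3 -> 'I_3 -> {linear V i -> V i}.
Hypothesis e_bracket : forall i a b c d x,
  e i a b (e i c d x) - e i c d (e i a b x)
  = (b == c)%:R *: e i a d x - (d == a)%:R *: e i c b x.
Variables (v : forall i, V i) (la : 'I_n -> 'rV[K]_3).
Hypothesis e_raise : forall i (a b : 'I_3), (a < b)%N -> e i a b (v i) = 0.
Hypothesis e_diag : forall i a, e i a a (v i) = la i 0 a *: v i.
Variable E : 'I_n -> 'I_3 -> 'I_3 -> {linear T -> T}.
Hypothesis E_t : forall i a b w, E i a b (t w) = t (dfwith w (e i a b (w i))).
Variable Phi : {linear {mpoly K[n * 3]} -> T}.
Hypothesis Phi_t : forall m : 'X_{1..n * 3}, Phi 'X_[m] = t (fun i =>
  pbw (e i) (v i) (m (xvar i 0)) (m (xvar i 2)) (m (xvar i 1))).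
Hypothesis Phi_bij : bijective Phi.

Lemma factor_actions_commute i j a b c d x : i != j ->
  E i a b (E j c d x) = E j c d (E i a b x).
Proof.
move=> ij; have [Psi _ PhiK] := Phi_bij; rewrite -(PhiK x).
move: (Psi x); apply: mpoly_linear_ext => [k p q|k p q|m]; first by rewrite !linearP.
  by rewrite !linearP.
rewrite Phi_t !E_t; congr t; apply: functional_extensionality_dep => k.
rewrite [dfwith _ _ i]dfwith_out 1?eq_sym // [dfwith _ _ j]dfwith_out //.
have [<-|ik] := eqVneq i k; first by rewrite dfwith_in dfwith_out 1?eq_sym // dfwith_in.
have [<-|jk] := eqVneq j k; first by rewrite dfwith_in dfwith_out // dfwith_in.
by rewrite !dfwith_out.
Qed.

Local Notation X i k := ('X_(xvar i k) : {mpoly K[n * 3]}).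
Local Notation D i k p := (p^`M(xvar i k)).

Lemma deg0_casimir_preimage i j p q : i != j ->
    Phi q = \sum_a \sum_b E i a b (E j b a (Phi p)) ->
  deg0 q = omega0 (\sum_a la i 0 a * la j 0 a)
      (la i 0 0 - la i 0 1) (la j 0 0 - la j 0 1)
      (la i 0 1 - la i 0 2) (la j 0 1 - la j 0 2) i j (deg0 p)
    + (X i 0 * X j 1 - X i 1 * X j 0) * (deg0 (D i 2 p) - deg0 (D j 2 p)).
Proof.
move=> ij; have [Psi PhiK PsiK] := Phi_bij.
(* The swap makes multiplication by x_3^(j) the outer operator. The images under [E i 0 2] and
   [E j 0 2] are then only named through [Psi], never computed, since [deg0_X2] discards them. *)
rewrite -(deg0_casimir (la i) (la j) p ij) !sum_I3 (factor_actions_commute 0 2 2 0 _ ij).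
rewrite -[E i 0 2 (Phi p)]PsiK -[E j 0 2 (Phi p)]PsiK.
have t10 := transfer_10 E_t Phi_t.
have t20 := transfer_20 e_bracket E_t Phi_t.
have t21 := transfer_21 t_lin e_bracket E_t Phi_t.
have t01 := transfer_01 t_lin e_bracket e_raise e_diag E_t Phi_t.
have t12 := transfer_12 t_lin e_bracket e_raise e_diag E_t Phi_t.
have tdiag := transfer_diag t_lin e_bracket e_diag E_t Phi_t.
rewrite !t20 !t21 !t12 !t10 !t01 !t10 !t21 !tdiag.
have PhiD r s : Phi r + Phi s = Phi (r + s) by rewrite linearD.
rewrite !PhiD => /(can_inj PhiK) ->.
move: (opdiag _ 0 i _) (opdiag _ 1 i _) (opdiag _ 2 i _).
move: (op01 _ i _) (X i 0 * op01 _ j _) (op12 _ i _) (op21 i _) => p1 p2 p3 p4 d1 d2 d3.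
rewrite 8!deg0D !deg0_X2.
ring.
Qed.

Variables (g : 'I_n -> 'I_n -> K) (mu : 'I_n -> K) (F : {mpoly K[n * 3]}).
Hypothesis F_eigen : forall i,
  \sum_(j | j != i) g i j *: (\sum_a \sum_b E i a b (E j b a (Phi F)))
  = mu i *: Phi F.

(** The hypothesis on [w] is the vanishing of the minors of x_1, x_2 in row i, so the unknown degree
    1 contribution disappears at [w] from each summand. *)
Lemma deg0_eigen_vanish i (w : 'I_(n * 3) -> K) :
    (forall j, w (xvar i 0) * w (xvar j 1) = w (xvar i 1) * w (xvar j 0)) ->
  (\sum_(j | j != i) g i j *: omega0 (\sum_a la i 0 a * la j 0 a)
      (la i 0 0 - la i 0 1) (la j 0 0 - la j 0 1)
      (la i 0 1 - la i 0 2) (la j 0 1 - la j 0 2) i j (deg0 F)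
    - mu i *: deg0 F).@[w] = 0.
Proof.
move=> ww; have [Psi PhiK PsiK] := Phi_bij.
pose q j := Psi (\sum_a \sum_b E i a b (E j b a (Phi F))).
have Fq : \sum_(j | j != i) g i j *: q j = mu i *: F.
  apply: (can_inj PhiK); rewrite [RHS]linearZ /= -F_eigen raddf_sum.
  by apply: eq_bigr => j _; rewrite /= linearZ /= PsiK.
rewrite -deg0Z -Fq (linear_sum (@deg0 K n)) -sumrB raddf_sum big1 // => j ij /=.
rewrite deg0Z (@deg0_casimir_preimage i j F (q j)) 1?eq_sym ?PsiK //=.
by rewrite -scalerBr mevalZ opprD addNKr mevalN !(mevalM, mevalB, mevalXU)
  ww subrr mul0r oppr0 mulr0.
Qed.

End CasimirDegree0.

(** * Derivatives in the separated variables *)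

(** A nonzero difference would have as many distinct natural numbers as roots as its size, one too
    many. *)
Lemma poly_eq_values (K : numDomainType) (p q : {poly K}) :
  (forall s, p.[s] = q.[s]) -> p = q.
Proof.
move=> pq; apply/eqP; rewrite -subr_eq0; apply/negPn/negP => nz.
pose rs := [seq i%:R | i <- iota 0 (size (p - q))] : seq K.
have := max_poly_roots (rs := rs) nz; rewrite size_map size_iota ltnn.
suff [-> ->] : all (root (p - q)) rs /\ uniq rs by move=> /(_ isT isT).
split; first by apply/allP => s _; rewrite rootE hornerD hornerN pq subrr.
rewrite map_inj_in_uniq ?iota_uniq // => i k _ _ /eqP.
by rewrite eqr_nat => /eqP.
Qed.

Section Lines.
Variables (K : numFieldType) (N : nat).
Implicit Types (A B : 'I_N -> K) (p q : {mpoly K[N]}).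

(** Restriction to a line as a univariate polynomial, so that directional derivatives are formal
    derivatives. *)
Definition mpoly_line A B p : {poly K} :=
  mmap (@polyC K) (fun i => (A i)%:P + (B i)%:P * 'X) p.

Lemma horner_line A B p s :
  (mpoly_line A B p).[s] = p.@[fun i => A i + s * B i].
Proof.
rewrite /mpoly_line /mmap mevalE horner_sum; apply: eq_bigr => m _.
rewrite hornerM hornerC; congr (_ * _).
rewrite /mmap1 horner_prod; apply: eq_bigr => i _.
by rewrite horner_exp !hornerE mulrC.
Qed.

Lemma deriv_line A B p :
  (mpoly_line A B p)^`() = \sum_i (B i)%:P * mpoly_line A B p^`M(i).
Proof.
pose P (q : {mpoly K[N]}) := (mpoly_line A B q)^`() = \sum_i (B i)%:P * mpoly_line A B q^`M(i).
have P1 : P 1.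
  rewrite /P /mpoly_line rmorph1 derivC big1 // => i _.
  by rewrite -mpolyC1 mderivC raddf0 mulr0.
have PM q r : P q -> P r -> P (q * r).
  rewrite /P /mpoly_line rmorphM derivM => -> ->.
  rewrite mulr_suml mulr_sumr -big_split; apply: eq_bigr => i _ /=.
  by rewrite mderivM rmorphD !rmorphM /=; ring.
have PX i : P 'X_i.
  rewrite /P /mpoly_line mmapX mmap1U derivD derivM !derivC derivX.
  rewrite add0r mul0r add0r mulr1 (bigD1 i) //= mderivXU eqxx rmorph1 mulr1.
  rewrite big1 ?addr0 // => j; rewrite mderivXU eq_sym => /negPf ->.
  by rewrite raddf0 mulr0.
rewrite -/(P p); elim/mpolyind: p => [|c m p _ _ IH].
  rewrite /P /mpoly_line raddf0 deriv0 big1 // => i _.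
  by rewrite mderiv0 raddf0 mulr0.
have Pm : P 'X_[m].
  rewrite mpolyXE_id; apply: (big_ind P) => // i _.
  by elim: (m i) => [|k IHk]; rewrite ?expr0 // exprS; apply: PM.
move: IH Pm; rewrite /P /mpoly_line => IH Pm.
rewrite mmapD mmapZ derivD IH mul_polyC derivZ Pm scaler_sumr -big_split.
apply: eq_bigr => i _ /=; rewrite mderivD mderivZ mmapD mmapZ mulrDr.
by rewrite -!mul_polyC mulrCA.
Qed.

End Lines.

(** A chain rule that needs only equality of values along two lines. It suffices for the change of
    variables because x is affine in each single y_k^(j). *)
Lemma directional_deriv_eq (K : numFieldType) N M (A B : 'I_N -> K) (A' B' : 'I_M -> K)
    (p : {mpoly K[N]}) (q : {mpoly K[M]}) :
  (forall s, p.@[fun i => A i + s * B i] = q.@[fun i => A' i + s * B' i]) ->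
  \sum_i B i * p^`M(i).@[A] = \sum_i B' i * q^`M(i).@[A'].
Proof.
move=> pq.
have : mpoly_line A B p = mpoly_line A' B' q.
  by apply: poly_eq_values => s; rewrite !horner_line.
move/(congr1 (fun r => r^`().[0])); rewrite !deriv_line !horner_sum.
have at0 n (C C' : 'I_n -> K) r : (mpoly_line C C' r).[0] = r.@[C].
  by rewrite horner_line; apply: meval_eq => i; rewrite mul0r addr0.
by under eq_bigr do rewrite hornerM hornerC at0; under [RHS]eq_bigr do
  rewrite hornerM hornerC at0.
Qed.

Lemma directional_deriv2_eq (K : numFieldType) N M
    (A B C : 'I_N -> K) (A' B' C' : 'I_M -> K)
    (p : {mpoly K[N]}) (q : {mpoly K[M]}) :
  (forall s r, p.@[fun i => A i + s * B i + r * C i]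
     = q.@[fun i => A' i + s * B' i + r * C' i]) ->
  \sum_i \sum_k B i * C k * p^`M(k)^`M(i).@[A]
  = \sum_i \sum_k B' i * C' k * q^`M(k)^`M(i).@[A'].
Proof.
move=> pq.
(* Differentiating in [r] at every [s] shows that these first derivatives agree along the lines in
   [s], which allows a second differentiation. *)
pose p' := \sum_k C k *: p^`M(k); pose q' := \sum_k C' k *: q^`M(k).
have : \sum_i B i * p'^`M(i).@[A] = \sum_i B' i * q'^`M(i).@[A'].
  apply: directional_deriv_eq => s; rewrite /p' /q' !raddf_sum /=.
  under eq_bigr do rewrite mevalZ; under [RHS]eq_bigr do rewrite mevalZ.
  exact: directional_deriv_eq (pq s).
have expand n (D : 'I_n -> K) D' (A0 : 'I_n -> K) (r : {mpoly K[n]}) :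
    \sum_i D i * (\sum_k D' k *: r^`M(k))^`M(i).@[A0]
    = \sum_i \sum_k D i * D' k * r^`M(k)^`M(i).@[A0].
  apply: eq_bigr => i _; rewrite (raddf_sum (mderiv i)) (raddf_sum (meval A0)) mulr_sumr.
  apply: eq_bigr => k _ /=.
  by rewrite mderivZ mevalZ mulrA.
by rewrite !expand.
Qed.

Lemma sum_mxvec_index (V : nmodType) m n (g : 'I_(m * n) -> V) :
  \sum_s g s = \sum_i \sum_j g (mxvec_index i j).
Proof.
rewrite pair_big (reindex _ (curry_mxvec_bij _ _)) /=.
by apply: eq_bigr => -[].
Qed.

(* The sum is the leading coefficient of the Lagrange interpolant of [p].      *)
Lemma sum_lagrange_eq0 (K : fieldType) n (z : 'I_n -> K) (p : {poly K}) :
    injective z -> (size p < n)%N ->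
  \sum_i p.[z i] / \prod_(s | s != i) (z i - z s) = 0.
Proof.
move=> z_inj pn.
pose l i := \prod_(s | s != i) ('X - (z s)%:P).
have z_neq i s : s != i -> z i - z s != 0.
  by move=> si; rewrite subr_eq0 (inj_eq z_inj) eq_sym.
pose c i := p.[z i] / \prod_(s | s != i) (z i - z s).
have l_monic i : l i \is monic by apply: monic_prod => s _; apply: monicXsubC.
have l_at i k : (l i).[z k] = (\prod_(s | s != i) (z i - z s)) *+ (i == k).
  rewrite /l horner_prod; case: eqP => [<-|/eqP ik].
    by apply: eq_bigr => s _; rewrite hornerXsubC.
  by rewrite (bigD1 k) 1?eq_sym //= hornerXsubC subrr mul0r.
have size_l i : size (l i) = n.
  rewrite /l -big_filter size_prod_XsubC size_filter -sum1_count sum1_card.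
  by rewrite cardC1 card_ord prednK // (leq_trans _ (ltn_ord i)).
have pE : p = \sum_i c i *: l i.
  apply/eqP; rewrite -subr_eq0; apply/negPn/negP => nz.
  have := max_poly_roots (rs := [seq z i | i : 'I_n]) nz.
  rewrite size_map -cardE card_ord map_inj_uniq ?enum_uniq //.
  suff [-> ltn] : all (root (p - \sum_i c i *: l i)) [seq z i | i : 'I_n]
      /\ (size (p - \sum_i c i *: l i)%R <= n)%N.
    by move=> /(_ isT isT); rewrite ltnNge ltn.
  split.
    apply/allP => _ /mapP[k _ ->]; rewrite rootE hornerD hornerN horner_sum.
    rewrite (bigD1 k) //= hornerZ l_at eqxx mulr1n [X in _ - (_ + X)]big1 => [|i /negPf ik].
      rewrite addr0 /c mulfVK ?subrr //; apply/prodf_neq0 => s; exact: z_neq.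
    by rewrite hornerZ l_at ik mulr0n mulr0.
  apply: leq_trans (size_polyD _ _) _; rewrite geq_max (ltnW pn) size_polyN.
  apply: leq_trans (size_sum _ _ _) _; apply/bigmax_leqP => i _.
  by apply: leq_trans (size_scale_leq _ _) _; rewrite size_l.
(* Each [l i] is monic of size [n], whereas [p] is too small to have a coefficient of index
   [n.-1]. *)
have := congr1 (fun q : {poly K} => q`_n.-1) pE.
rewrite nth_default; last by case: (n) pn.
rewrite coef_sum => coef0; rewrite [RHS]coef0; apply: eq_bigr => i _; rewrite coefZ.
by have /monicP := l_monic i; rewrite /lead_coef size_l => ->; rewrite mulr1.
Qed.

(** After exchanging i and k in the second half, [T i k] has coefficient (w_i - w_k) / (z_i - z_k) =
    w_i w_k, with w_i = 1 / (y - z_i). The diagonal is added for free, giving full sums in k. *)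
Lemma sum_symmetrize (K : fieldType) n (z : 'I_n -> K) (y : K) (T : 'I_n -> 'I_n -> K) :
    injective z -> (forall i, y != z i) -> (forall i, T i i = 0) ->
  \sum_i (y - z i)^-1 * \sum_(k | k != i) (z i - z k)^-1 * (T i k + T k i)
  = \sum_i \sum_k (y - z i)^-1 * (y - z k)^-1 * T i k.
Proof.
move=> z_inj yz T0.
under eq_bigr do rewrite mulr_sumr.
under eq_bigr do under eq_bigr do rewrite mulrDr mulrDr.
under eq_bigr do rewrite big_split.
rewrite big_split /= [X in _ + X](exchange_big_dep xpredT) //= -big_split /=.
apply: eq_bigr => i _; rewrite [RHS](bigD1 i) //= T0 mulr0 add0r.
under [X in _ + X]eq_bigl do rewrite eq_sym.
rewrite -big_split /=; apply: eq_bigr => k ki.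
have zik : z i - z k != 0 by rewrite subr_eq0 (inj_eq z_inj) eq_sym.
have yi : y - z i != 0 by rewrite subr_eq0.
have yk : y - z k != 0 by rewrite subr_eq0.
have -> : z k - z i = - (z i - z k) by rewrite opprB.
have zE : z i - z k = (y - z k) - (y - z i) by ring.
by rewrite zE in zik *; field; rewrite yi yk oppr_eq0 zik.
Qed.

(* [x i], [y i] stand for [x_1^(i)], [x_2^(i)] and [w i] for                  *)
(* [1 / (y_1^(j) - z_i)], so that [wx] and [wy] say that [y_1^(j)] is a zero   *)
(* of the two generating functions defining the separated variables.           *)
Lemma sum_separated (K : comNzRingType) n (w x y a b d1 d2 : 'I_n -> K)
    (d11 d12 d22 : 'I_n -> 'I_n -> K) :
    \sum_k w k * x k = 0 -> \sum_k w k * y k = 0 ->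
  \sum_i \sum_k w i * w k *
    (x k * y i * (d12 i i - d12 i k) - x i * x k * (d11 i i - d11 i k)
     - y i * y k * (d22 i i - d22 i k)
     + a i * x k * (d1 i - d1 k) + b i * y k * (d2 i - d2 k))
  = \sum_i \sum_k (w i * x i) * (w k * x k) * d11 i k
    - \sum_i \sum_k (w i * y i) * (w k * x k) * d12 i k
    + \sum_i \sum_k (w i * y i) * (w k * y k) * d22 i k
    - (\sum_i w i * x i * d1 i) * (\sum_i a i * w i)
    - (\sum_i w i * y i * d2 i) * (\sum_i b i * w i).
Proof.
move=> wx wy.
have addzx (g : 'I_n -> K) s : s = s + \sum_i \sum_k g i * (w k * x k).
  by rewrite big1 ?addr0 // => i _; rewrite -mulr_sumr wx mulr0.
have addzy (g : 'I_n -> K) s : s = s + \sum_i \sum_k g i * (w k * y k).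
  by rewrite big1 ?addr0 // => i _; rewrite -mulr_sumr wy mulr0.
have prod (g h : 'I_n -> K) :
    (\sum_i g i) * (\sum_i h i) = \sum_i \sum_k h i * g k.
  by rewrite mulrC mulr_suml; apply: eq_bigr => i _; rewrite mulr_sumr.
(* [g i] and [h i] are the coefficients of [w k * x k] and [w k * y k] in the terms whose
   derivatives involve i alone; these are the terms killed by [wx] and [wy]. *)
pose g i := w i * y i * d12 i i - w i * x i * d11 i i + a i * w i * d1 i.
pose h i := b i * w i * d2 i - w i * y i * d22 i i.
rewrite !prod [RHS](addzx g) [RHS](addzy h).
rewrite -!sumrN -!big_split; apply: eq_bigr => i _ /=.
rewrite -!sumrN -!big_split; apply: eq_bigr => k _ /=.
by rewrite /g /h; ring.
Qed.

Section MatrixEvaluation.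
Variable K : numFieldType.

Definition mxeval a b (A : 'M[K]_(a, b)) (p : {mpoly K[a * b]}) : K :=
  p.@[fun s => mxvec A 0 s].

Lemma mxeval_directional_deriv a b a' b'
    (A B : 'M[K]_(a, b)) (A' B' : 'M[K]_(a', b')) p q :
  (forall s, mxeval (A + s *: B) p = mxeval (A' + s *: B') q) ->
  \sum_i \sum_k B i k * mxeval A p^`M(mxvec_index i k)
  = \sum_i \sum_k B' i k * mxeval A' q^`M(mxvec_index i k).
Proof.
move=> pq.
have := @directional_deriv_eq K _ _ (fun s => mxvec A 0 s) (fun s => mxvec B 0 s)
  (fun s => mxvec A' 0 s) (fun s => mxvec B' 0 s) p q.
rewrite !sum_mxvec_index => H.
under eq_bigr do under eq_bigr do rewrite -mxvecE.
under [RHS]eq_bigr do under eq_bigr do rewrite -mxvecE.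
apply: H => s; move: (pq s); rewrite /mxeval !linearD !linearZ /=.
by under meval_eq do rewrite !mxE; under [RHS]meval_eq do rewrite !mxE.
Qed.

Lemma mxeval_directional_deriv2 a b a' b'
    (A B C : 'M[K]_(a, b)) (A' B' C' : 'M[K]_(a', b')) p q :
  (forall s r, mxeval (A + s *: B + r *: C) p = mxeval (A' + s *: B' + r *: C') q) ->
  \sum_i \sum_k B i k * (\sum_i' \sum_k' C i' k' *
     mxeval A p^`M(mxvec_index i' k')^`M(mxvec_index i k))
  = \sum_i \sum_k B' i k * (\sum_i' \sum_k' C' i' k' *
     mxeval A' q^`M(mxvec_index i' k')^`M(mxvec_index i k)).
Proof.
move=> pq.
have H := @directional_deriv2_eq K _ _ (fun s => mxvec A 0 s) (fun s => mxvec B 0 s)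
  (fun s => mxvec C 0 s) (fun s => mxvec A' 0 s) (fun s => mxvec B' 0 s)
  (fun s => mxvec C' 0 s) p q.
have expand m m' (D E F : 'M[K]_(m, m')) r :
    \sum_i \sum_k E i k * (\sum_i' \sum_k' F i' k' *
       mxeval D r^`M(mxvec_index i' k')^`M(mxvec_index i k))
    = \sum_s \sum_t mxvec E 0 s * mxvec F 0 t
        * r^`M(t)^`M(s).@[fun s => mxvec D 0 s].
  rewrite sum_mxvec_index; apply: eq_bigr => i _; apply: eq_bigr => k _.
  rewrite sum_mxvec_index mulr_sumr; apply: eq_bigr => i' _.
  by rewrite mulr_sumr; apply: eq_bigr => k' _; rewrite !mxvecE mulrA.
rewrite !expand; apply: H => s r; move: (pq s r).
rewrite /mxeval !linearD !linearZ /=.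
by under meval_eq do rewrite !mxE; under [RHS]meval_eq do rewrite !mxE.
Qed.

End MatrixEvaluation.

(** * The chain rule for the change of variables *)

Section SeparatedVariables.
Variables (K : numFieldType) (n : nat) (z : 'I_n -> K).
Hypothesis z_inj : injective z.

Definition xmx (u : 'rV[K]_3) (y : 'M[K]_(n.-1, 3)) : 'M[K]_(n, 3) :=
  \matrix_(i, k) (u 0 k * (\prod_j (z i - y j k))
                  / \prod_(s | s != i) (z i - z s)).

Variables (u : 'rV[K]_3) (y : 'M[K]_(n.-1, 3)) (j : 'I_n.-1).
Local Notation X := (xmx u y).

(* d x / d y_k^(j), by logarithmic differentiation.                            *)
Definition dxmx (k : 'I_3) : 'M[K]_(n, 3) :=
  \matrix_(i, k') (if k' == k then (y j k - z i)^-1 * X i k else 0).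

(** Only one factor of each product in column k or l depends on the shifted entry, and linearly, so
    there is no remainder, even for k = l. *)
Lemma xmx_shift k l s r :
    (forall i, y j k != z i) -> (forall i, y j l != z i) ->
  xmx u (y + s *: delta_mx j k + r *: delta_mx j l)
  = X + s *: dxmx k + r *: dxmx l.
Proof.
move=> yk yl; apply/matrixP => i m; rewrite !mxE (bigD1 j) //=.
rewrite (eq_bigr (fun j' => z i - y j' m)) => [|j' /negPf jj']; last first.
  by rewrite !mxE jj' /= !mulr0 !addr0.
rewrite !mxE eqxx /=; move: (\prod_(s0 | s0 != i) _)^-1 => Q.
have nz q : (forall i, y j q != z i) -> m = q -> z i - y j m != 0.
  by move=> yq ->; rewrite subr_eq0 eq_sym.
have := nz _ yl; have := nz _ yk.
have inv q : (y j q - z i)^-1 = - (z i - y j q)^-1 by rewrite -invrN opprB.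
case: (m =P k) => [<-|_] => [/(_ erefl) ?|_]; case: (m =P l) => [<-|_] => [/(_ erefl) ?|_];
  rewrite ?inv ?mulr0 ?addr0 ?mulr1 ?(bigD1 (P := xpredT) j) //=; try field; done.
Qed.

Lemma sum_dxmx k (g : 'I_n -> 'I_3 -> K) :
  \sum_i \sum_k' dxmx k i k' * g i k'
  = \sum_i ((y j k - z i)^-1 * X i k) * g i k.
Proof.
apply: eq_bigr => i _; rewrite (bigD1 k) //= big1 => [|k' /negPf k'k].
  by rewrite addr0 [dxmx _ _ _]mxE eqxx.
by rewrite mxE k'k mul0r.
Qed.

Lemma sum_delta_mx m m' (i0 : 'I_m) (k0 : 'I_m') (g : 'I_m -> 'I_m' -> K) :
  \sum_i \sum_k (delta_mx i0 k0 : 'M[K]_(m, m')) i k * g i k = g i0 k0.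
Proof.
rewrite (bigD1 i0) //= [X in _ + X]big1 => [|i /negPf ii0]; last first.
  by rewrite big1 // => k _; rewrite mxE ii0 mul0r.
rewrite (bigD1 k0) //= big1 => [|k /negPf kk0]; last by rewrite mxE kk0 andbF mul0r.
by rewrite mxE !eqxx mul1r !addr0.
Qed.

(* [sum_i x_k^(i) / (t - z_i)] vanishes at [t = y_k^(j)].                      *)
Lemma sum_xmx_eq0 k : (forall i, y j k != z i) ->
  \sum_i (y j k - z i)^-1 * X i k = 0.
Proof.
move=> yk.
(* The factor z_i - y_k^(j) cancels the denominator up to the sign in [p]; a polynomial of size n -
   1 evaluated at z_i remains. *)
pose p := - u 0 k *: \prod_(j' | j' != j) ('X - (y j' k)%:P).
rewrite -[RHS](@sum_lagrange_eq0 K n z p) //.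
  apply: eq_bigr => i _; rewrite !mxE (bigD1 j) //= /p hornerZ horner_prod.
  under [in RHS]eq_bigr do rewrite hornerXsubC.
  have nz : y j k - z i != 0 by rewrite subr_eq0.
  rewrite -[z i - y j k]opprB; move: (y j k - z i) nz => c nz.
  by move: (\prod_(_ | _) _) (\prod_(_ | _) _)^-1 => P Q; field.
apply: leq_ltn_trans (size_scale_leq _ _) _.
rewrite -big_filter size_prod_XsubC size_filter -sum1_count sum1_card cardC1 card_ord.
have j_gt0 : (0 < n.-1)%N := leq_ltn_trans (leq0n j) (ltn_ord j).
by rewrite prednK //; move: j_gt0; case: (n).
Qed.

Variables (p : {mpoly K[n * 3]}) (f : {mpoly K[n.-1 * 2]}) (l1 l2 : nat).
Hypothesis p_f : forall u y, mxeval (xmx u y) p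
  = u 0 0 ^+ l1 * u 0 1 ^+ l2 * mxeval (col' ord_max y) f.

Let col_delta k : col' ord_max (delta_mx j (lift ord_max k)) = delta_mx j k :> 'M[K]_(_, 2).
Proof. by apply/matrixP => i l; rewrite !mxE (inj_eq lift_inj). Qed.

Lemma deriv_xmx (k : 'I_2) : (forall i, y j (lift ord_max k) != z i) ->
  \sum_i ((y j (lift ord_max k) - z i)^-1 * X i (lift ord_max k))
     * mxeval X p^`M(xvar i (lift ord_max k))
  = u 0 0 ^+ l1 * u 0 1 ^+ l2 * mxeval (col' ord_max y) f^`M(mxvec_index j k).
Proof.
move=> yk.
rewrite -(sum_dxmx _ (fun i k => mxeval X p^`M(xvar i k))).
pose q := (u 0 0 ^+ l1 * u 0 1 ^+ l2) *: f.
rewrite (@mxeval_directional_deriv _ _ _ _ _ _ _ (col' ord_max y) (delta_mx j k) _ q).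
  by rewrite sum_delta_mx /q mderivZ /mxeval mevalZ.
move=> s; rewrite /q [RHS]mevalZ -/(mxeval _ _) -col_delta.
have := xmx_shift s 0 yk yk; rewrite !scale0r !addr0 => <-.
by rewrite p_f; congr (_ * mxeval _ _); apply/matrixP => i l; rewrite !mxE.
Qed.

(** No first derivatives of [p] appear: by [xmx_shift], the second derivatives of x in y_k^(j),
    y_l^(j) vanish. *)
Lemma deriv2_xmx (k l : 'I_2) :
    (forall i, y j (lift ord_max k) != z i) -> (forall i, y j (lift ord_max l) != z i) ->
  \sum_i ((y j (lift ord_max k) - z i)^-1 * X i (lift ord_max k)) *
    (\sum_i' ((y j (lift ord_max l) - z i')^-1 * X i' (lift ord_max l))
     * mxeval X p^`M(xvar i' (lift ord_max l))^`M(xvar i (lift ord_max k)))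
  = u 0 0 ^+ l1 * u 0 1 ^+ l2
    * mxeval (col' ord_max y) f^`M(mxvec_index j l)^`M(mxvec_index j k).
Proof.
move=> yk yl.
under eq_bigr => i _.
  rewrite -(sum_dxmx _ (fun i' l => mxeval X p^`M(xvar i' l)^`M(xvar i (lift ord_max k)))).
  over.
rewrite -(sum_dxmx _ (fun i k => \sum_i' \sum_l' dxmx (lift ord_max l) i' l'
  * mxeval X p^`M(xvar i' l')^`M(xvar i k))).
pose q := (u 0 0 ^+ l1 * u 0 1 ^+ l2) *: f.
rewrite (@mxeval_directional_deriv2 _ _ _ _ _ _ _ _ (col' ord_max y)
  (delta_mx j k) (delta_mx j l) _ q).
  by rewrite !sum_delta_mx /q !mderivZ /mxeval mevalZ.
move=> s r; rewrite /q [RHS]mevalZ -/(mxeval _ _) -!col_delta.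
rewrite -xmx_shift // p_f.
by congr (_ * mxeval _ _); apply/matrixP => i l'; rewrite !mxE.
Qed.

End SeparatedVariables.

(** * The differential operator in the separated variables *)

Section Separation.
Variables (K : numFieldType) (n : nat) (z : 'I_n -> K).
Hypothesis z_inj : injective z.

Local Notation D i k p := (p^`M(xvar i k)).

(* The [T_ik] of the introduction, [P] being evaluation at a point.            *)
Definition omega0_half (a b : K) (P : {mpoly K[n * 3]} -> K)
    (i k : 'I_n) (p : {mpoly K[n * 3]}) : K :=
  let x i := P 'X_(xvar i 0) in let y i := P 'X_(xvar i 1) in
  x k * y i * (P (D i 1 (D i 0 p)) - P (D i 1 (D k 0 p)))
  - x i * x k * (P (D i 0 (D i 0 p)) - P (D i 0 (D k 0 p)))
  - y i * y k * (P (D i 1 (D i 1 p)) - P (D i 1 (D k 1 p)))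
  + a * x k * (P (D i 0 p) - P (D k 0 p))
  + b * y k * (P (D i 1 p) - P (D k 1 p)).

Lemma meval_omega0 (c a1 b1 a2 b2 : K) i k (p : {mpoly K[n * 3]}) v :
  (omega0 c a1 b1 a2 b2 i k p).@[v]
  = c * p.@[v] + (omega0_half a1 a2 (meval v) i k p + omega0_half b1 b2 (meval v) k i p).
Proof.
rewrite /omega0 /omega0_half /= !mderivB.
rewrite (mderiv_comm (xvar i 0) (xvar k 0)) (mderiv_comm (xvar i 1) (xvar k 1)).
rewrite !(mevalB, mevalD, mevalN, mevalM, mevalZ, mevalXU).
move: (D i 0 (D i 0 p)).@[v] (D i 0 (D k 0 p)).@[v] (D k 0 (D k 0 p)).@[v].
move: (D i 1 (D i 1 p)).@[v] (D i 1 (D k 1 p)).@[v] (D k 1 (D k 1 p)).@[v].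
move: (D i 1 (D i 0 p)).@[v] (D i 1 (D k 0 p)).@[v] (D k 1 (D i 0 p)).@[v].
move: (D k 1 (D k 0 p)).@[v] (D i 0 p).@[v] (D k 0 p).@[v] (D i 1 p).@[v].
move: (D k 1 p).@[v] p.@[v] => *.
ring.
Qed.

Variables (c : 'I_n -> 'I_n -> K) (a b mu : 'I_n -> K).
Variables (p : {mpoly K[n * 3]}) (f : {mpoly K[n.-1 * 2]}) (l1 l2 : nat).
Hypothesis p_f : forall u y, mxeval (xmx z u y) p
  = u 0 0 ^+ l1 * u 0 1 ^+ l2 * mxeval (col' ord_max y) f.

(** Since [y j 0 = y j 1], the same weights 1 / (y_1^(j) - z_i) annihilate both columns x_1, x_2 and
    produce both derivatives d/dy_1^(j) and d/dy_2^(j). *)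
Lemma separated_form (j : 'I_n.-1) (u : 'rV[K]_3) (y : 'M[K]_(n.-1, 3)) :
    y j 0 = y j 1 -> (forall i, y j 0 != z i) ->
  \sum_i (y j 0 - z i)^-1 * mxeval (xmx z u y)
    (\sum_(k | k != i) (z i - z k)^-1
       *: omega0 (c i k) (a i) (a k) (b i) (b k) i k p - mu i *: p)
  = u 0 0 ^+ l1 * u 0 1 ^+ l2 *
    (mxeval (col' ord_max y) f^`M(mxvec_index j 0)^`M(mxvec_index j 0)
     - mxeval (col' ord_max y) f^`M(mxvec_index j 0)^`M(mxvec_index j 1)
     + mxeval (col' ord_max y) f^`M(mxvec_index j 1)^`M(mxvec_index j 1)
     - mxeval (col' ord_max y) f^`M(mxvec_index j 0)
       * (\sum_i a i / (y j 0 - z i))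
     - mxeval (col' ord_max y) f^`M(mxvec_index j 1)
       * (\sum_i b i / (y j 0 - z i))
     + mxeval (col' ord_max y) f
       * (\sum_i (y j 0 - z i)^-1
            * (- mu i + \sum_(k | k != i) c i k / (z i - z k)))).
Proof.
move=> y01 yz.
have yz1 i : y j 1 != z i by rewrite -y01.
have e0 : lift ord_max 0 = 0 :> 'I_3 by apply: val_inj.
have e1 : lift ord_max 1 = 1 :> 'I_3 by apply: val_inj.
pose X := xmx z u y; pose w i := (y j 0 - z i)^-1.
pose P := @meval (n * 3) K (fun s => mxvec X 0 s).
have PX i k : P 'X_(xvar i k) = X i k by rewrite /P mevalXU mxvecE.
have wx : \sum_i w i * X i 0 = 0 by apply: sum_xmx_eq0.
have wy : \sum_i w i * X i 1 = 0.
  by rewrite /w y01; apply: sum_xmx_eq0.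
have D0 := deriv_xmx u p_f (k := 0); rewrite e0 in D0; have {}D0 := D0 _ _ yz.
have D1 := deriv_xmx u p_f (k := 1); rewrite e1 in D1; have {}D1 := D1 _ _ yz1.
have D00 := deriv2_xmx u p_f (k := 0) (l := 0).
rewrite e0 in D00; have {}D00 := D00 _ _ yz yz.
have D11 := deriv2_xmx u p_f (k := 1) (l := 1).
rewrite e1 in D11; have {}D11 := D11 _ _ yz1 yz1.
have D10 := deriv2_xmx u p_f (k := 1) (l := 0).
rewrite e0 e1 in D10; have {}D10 := D10 _ _ yz1 yz.
rewrite -y01 in D1 D11 D10.
(* Splits off the terms without derivatives, which already form the last term of the result. *)
transitivity (\sum_i w i * \sum_(k | k != i) (z i - z k)^-1
      * (omega0_half (a i) (b i) P i k p + omega0_half (a k) (b k) P k i p)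
   + P p * (\sum_i w i * (- mu i + \sum_(k | k != i) c i k / (z i - z k)))).
  rewrite mulr_sumr -big_split; apply: eq_bigr => i _ /=.
  rewrite /mxeval mevalB mevalZ raddf_sum /=.
  under eq_bigr do rewrite mevalZ meval_omega0 mulrDr.
  rewrite big_split /= -/X -/P -/(w i).
  have -> : \sum_(k | k != i) (z i - z k)^-1 * (c i k * P p)
      = P p * \sum_(k | k != i) c i k / (z i - z k).
    by rewrite mulr_sumr; apply: eq_bigr => k _; ring.
  ring.
rewrite (sum_symmetrize (T := fun i k => omega0_half (a i) (b i) P i k p)) //; last first.
  by move=> i; rewrite /omega0_half /= !subrr !mulr0 !subr0 !addr0.
have split := sum_separated a b (fun i => P (D i 0 p)) (fun i => P (D i 1 p))
  (fun i k => P (D i 0 (D k 0 p))) (fun i k => P (D i 1 (D k 0 p)))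
  (fun i k => P (D i 1 (D k 1 p))) wx wy.
rewrite [X in X + _](_ : _ = \sum_i \sum_k (w i * X i 0) * (w k * X k 0) * P (D i 0 (D k 0 p))
    - \sum_i \sum_k (w i * X i 1) * (w k * X k 0) * P (D i 1 (D k 0 p))
    + \sum_i \sum_k (w i * X i 1) * (w k * X k 1) * P (D i 1 (D k 1 p))
    - (\sum_i w i * X i 0 * P (D i 0 p)) * (\sum_i a i * w i)
    - (\sum_i w i * X i 1 * P (D i 1 p)) * (\sum_i b i * w i)); last first.
  rewrite -split; apply: eq_bigr => i _; apply: eq_bigr => k _.
  by rewrite /omega0_half !PX.
have nest (g h : 'I_n -> K) (d : 'I_n -> 'I_n -> K) :
    \sum_i \sum_k g i * h k * d i k = \sum_i g i * \sum_k h k * d i k.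
  by apply: eq_bigr => i _; rewrite mulr_sumr; apply: eq_bigr => k _; rewrite mulrA.
rewrite !nest D00 D10 D11 D0 D1 [P p]p_f.
ring.
Qed.

End Separation.

(** Where y_1 = y_2, the vectors x_1 and x_2 are u_1 and u_2 times a common vector; the product form
    also covers u_k = 0. *)
Lemma xmx_proportional (K : numFieldType) n (z : 'I_n -> K) (u : 'rV[K]_3)
    (y : 'M[K]_(n.-1, 3)) (i k : 'I_n) : (forall j, y j 0 = y j 1) ->
  xmx z u y i 0 * xmx z u y k 1 = xmx z u y i 1 * xmx z u y k 0.
Proof.
move=> y01; have prod01 m : \prod_j (z m - y j 1) = \prod_j (z m - y j 0).
  by apply: eq_bigr => j _; rewrite y01.
by rewrite !mxE !prod01; ring.
Qed.

Lemma sum_mul_delta_diff (K : comNzRingType) m (la : 'rV[K]_m) a b :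
  \sum_k la 0 k * (delta_mx 0 a - delta_mx 0 b : 'rV[K]_m) 0 k = la 0 a - la 0 b.
Proof.
have sum_delta c : \sum_k la 0 k * (k == c)%:R = la 0 c.
  rewrite (bigD1 c) //= eqxx mulr1 big1 ?addr0 // => k /negPf ->.
  by rewrite mulr0.
by under eq_bigr do rewrite !mxE !eqxx mulrBr; rewrite sumrB !sum_delta.
Qed.

Theorem theorem1p5p1 (R : realType) (n : nat)
    (z : 'I_n -> R[i]) (z_inj : injective z)
    (La : 'I_n -> 'rV[R[i]]_3) (La_weight : forall i, is_weight (La i))
    (X : 'I_8 -> 'M[R[i]]_3) (X_basis : sl3_orthonormal_basis X)
    (V : 'I_n -> sl3_module R) (v : forall i, V i)
    (V_verma : forall i, is_verma (v i) (La i))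
    (T : lmodType R[i]) (t : (forall i, V i) -> T)
    (T_tensor : is_tensor_product t)
    (act : 'I_n -> 'M[R[i]]_3 -> {linear T -> T})
    (act_factor : is_factor_action t act)
    (Phi : {linear {mpoly R[i][n * 3]} -> T})
    (Phi_ident : is_polynomial_identification t v Phi)
    (l1 l2 : nat) (F : {mpoly R[i][n * 3]}) (F_neq0 : F != 0)
    (F_weight : has_weight act
       (\sum_i La i - l1%:R *: alpha1 R - l2%:R *: alpha2 R) (Phi F))
    (mu : 'I_n -> R[i])
    (F_eigen : forall i, gaudin z X act i (Phi F) = mu i *: Phi F)
    (f : {mpoly R[i][n.-1 * 2]})
    (F0_f : forall (u : 'rV[R[i]]_3) (y : 'M[R[i]]_(n.-1, 3)),
       mx_eval (xcoord z u y) (degree_part 0 F)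
       = u 0 0 ^+ l1 * u 0 1 ^+ l2 * y12_eval y f) :
  forall (j : 'I_n.-1) (u : 'rV[R[i]]_3) (y : 'M[R[i]]_(n.-1, 3)),
    in_diag y -> (forall i, y j 0 != z i) ->
    K0 z La mu j (degree_part 0 F) u y = 0
    /\ K0 z La mu j (degree_part 0 F) u y
       = u 0 0 ^+ l1 * u 0 1 ^+ l2 *
         (y12_eval y (f^`M(yvar j 0)^`M(yvar j 0))
          - y12_eval y (f^`M(yvar j 0)^`M(yvar j 1))
          + y12_eval y (f^`M(yvar j 1)^`M(yvar j 1))
          - y12_eval y (f^`M(yvar j 0))
            * (\sum_i wdot (La i) (alpha1 R) / (y j 0 - z i))
          - y12_eval y (f^`M(yvar j 1))
            * (\sum_i wdot (La i) (alpha2 R) / (y j 0 - z i))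
          + y12_eval y f
            * (\sum_i (y j 0 - z i)^-1
                 * (- mu i + \sum_(k | k != i)
                               wdot (La i) (La k) / (z i - z k)))).
Proof.
have [[t_lin _] [Phi_bij Phi_pbw]] := (T_tensor, Phi_ident).
have hw i : highest_weight_vector (v i) (La i) by have [] := V_verma i.
pose e i a b := sl3_act (V i) (unit_part R[i] a b).
pose E i a b := act i (unit_part R[i] a b).
have e_bracket i := rho_unit_bracket (@sl3_act_linear R (V i)) (@sl3_act_bracket R (V i)).
have e_diag i := rho_unit_diag (La_weight i) (proj2 (hw i)).
have e_raise i (a b : 'I_3) : (a < b)%N -> e i a b (v i) = 0.
  move=> ab; rewrite /e unit_part_neq ?(proj1 (hw i)) //.
  by apply: contraTneq ab => ->; rewrite ltnn.
have Phi_t m : Phi 'X_[m] = t (fun i =>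
    pbw (e i) (v i) (m (xvar i 0)) (m (xvar i 2)) (m (xvar i 1))).
  rewrite Phi_pbw; congr t; apply: functional_extensionality_dep => i.
  by rewrite /pbw_vector /pbw /e !unit_part_neq.
have E_t i a b w : E i a b (t w) = t (dfwith w (e i a b (w i))).
  by apply: act_factor; apply: mxtrace_unit_part.
have act_lin : forall i k A B x, \tr A = 0 -> \tr B = 0 ->
    act i (k *: A + B) x = k *: act i A x + act i B x.
  apply: (factor_act_linear t_lin (fun i => @sl3_act_linear R (V i)) act_factor Phi_bij).
  by move=> m; exists (pbw_vector v m).
have [X_tr [X_orth X_span]] := X_basis.
(* The eigenvalue equation is rewritten from the orthonormal basis [X] to the matrix units, whose
   action on monomials is known. *)
have eigen i : \sum_(k | k != i) (z i - z k)^-1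
    *: (\sum_a \sum_b E i a b (E k b a (Phi F))) = mu i *: Phi F.
  rewrite -F_eigen; apply: eq_bigr => k _; congr (_ *: _).
  rewrite /casimir (casimir_unit_part X_tr X_orth X_span
    (beta := fun A B => act i A (act k B (Phi F)))) //.
  - by move=> c A B M trA trB _; rewrite act_lin.
  - by move=> c A B M trA trB _; rewrite act_lin // linearP.
have alpha1E i : wdot (La i) (alpha1 R) = La i 0 0 - La i 0 1.
  exact: sum_mul_delta_diff.
have alpha2E i : wdot (La i) (alpha2 R) = La i 0 1 - La i 0 2.
  exact: sum_mul_delta_diff.
have vanish := deg0_eigen_vanish t_lin e_bracket e_raise e_diag E_t Phi_t Phi_bij eigen.
move=> j u y y_diag yz; split; last first.
  exact: (@separated_form R[i] n z z_inj (fun i k => wdot (La i) (La k))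
    (fun i => wdot (La i) (alpha1 R)) (fun i => wdot (La i) (alpha2 R)) mu
    (degree_part 0 F) f l1 l2 F0_f j u y (y_diag j) yz).
(* Each summand of [K0] vanishes by itself, by [vanish] at the point [xcoord z u y]. *)
rewrite /K0 big1 // => i _; rewrite -[RHS](mulr0 (y j 0 - z i)^-1); congr (_ * _).
have H0E : H0 z La i (degree_part 0 F) = \sum_(k | k != i) (z i - z k)^-1
    *: omega0 (\sum_a La i 0 a * La k 0 a) (La i 0 0 - La i 0 1)
      (La k 0 0 - La k 0 1) (La i 0 1 - La i 0 2) (La k 0 1 - La k 0 2)
      i k (deg0 F).
  by apply: eq_bigr => k _; rewrite -!alpha1E -!alpha2E.
rewrite H0E; apply: vanish => k.
by rewrite !mxvecE; apply: xmx_proportional.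
Qed.
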